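(* Let $G=(V,E)$ be a connected locally finite graph, let $\Gamma$ be a closed subgroup of $\mathrm{Aut}(G)$ that acts transitively on $G$, and let $\mathbf{w}$ be the relative weight function induced by $\Gamma$. Then the following are equivalent: (i) $G$ is $\mathbf{w}$-amenable; (ii) $G$ is level-amenable; (iii) $G$ is hyperfinite.
   Context: $\mathrm{Aut}(G)$ carries the topology of pointwise convergence. For $x\in V$, $\Gamma_x$ is the stabilizer of $x$ in $\Gamma$, and $\Gamma_x y$ is the $\Gamma_x$-orbit of $y$. The relative weight function is $\mathbf{w}^y(x):=|\Gamma_x y|/|\Gamma_y x|$ for $x,y\in V$. Fix a reference vertex $o\in V$; for $A\subseteq V$ put $\mathbf{w}^o(A)=\sum_{x\in A}\mathbf{w}^o(x)$. The notions below do not depend on $o$. $\mathbf{w}$-amenability: $\Phi^{\mathbf{w}}_V(G):=\inf\{\mathbf{w}^o(\partial_V F)/\mathbf{w}^o(F): F\subseteq V,\ 0<|F|<\infty\}=0$, where $\partial_V F$ is the external vertex boundary of $F$ (vertices outside $F$ adjacent to $F$). Level-amenability: the level of $x\in V$ is $\{y\in V:\mathbf{w}^x(y)=1\}$. A slice is a subgraph of $G$ induced by a finite union of levels. $G$ is level-amenable if every slice is amenable, i.e. every connected component $H$ of every slice is an amenable graph: $\inf\{|\partial_V K|/|K|: K\subseteq V(H),\ 0<|K|<\infty\}=0$ (boundary taken in $H$). Hyperfiniteness: a $\Gamma$-invariant random subgraph $\omega$ of $G$ is hyperfinite if there is an increasing family of random subgraphs $\omega_1\subseteq\omega_2\subseteq\cdots\subseteq\omega$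 such that the joint law of $(\omega,\{\omega_n\}_{n\in\mathbb{N}})$ is $\Gamma$-invariant, $\bigcup_n\omega_n=\omega$, and for every $n\ge 1$ all clusters (connected components) of $\omega_n$ are finite almost surely. $G$ is hyperfinite if this holds for the deterministic subgraph $\omega=G$. *)

(* Defs.v *)
From HB Require Import structures.
From Stdlib Require Import Relation_Operators.
From mathcomp Require Import all_boot all_order all_algebra finmap.
From mathcomp Require Import all_classical all_reals all_analysis.

Set Implicit Arguments.
Unset Strict Implicit.
Unset Printing Implicit Defensive.

Import Order.TTheory GRing.Theory Num.Theory.

Local Open Scope classical_set_scope.
Local Open Scope ring_scope.

(* Graphs are simple: undirected, without loops or multiple edges. *)
Record graph (V : Type) := Graph {
  adj : V -> V -> Prop;
  adj_sym : forall x y, adj x y -> adj y x;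
  adj_irrefl : forall x, ~ adj x x }.

Definition connected_graph V (G : graph V) :=
  forall x y, clos_refl_trans V (adj G) x y.

Definition locally_finite V (G : graph V) :=
  forall x, finite_set [set y | adj G x y].

Definition vertex_boundary V (e : V -> V -> Prop) (F : set V) : set V :=
  [set y | ~ F y /\ exists2 x, F x & e x y].

(* Cardinality of a finite set; the value is 0 on infinite sets. *)
Definition ncard (V : choiceType) (A : set V) : nat := #|` fset_set A|.

Section Automorphisms.
Variables (V : choiceType) (G : graph V).

Record aut := Aut {
  aut_fun :> V -> V;
  aut_inv : V -> V;
  aut_funK : cancel aut_fun aut_inv;
  aut_invK : cancel aut_inv aut_fun;
  aut_adj : forall x y, adj G (aut_fun x) (aut_fun y) <-> adj G x y }.

Lemma aut_eq (g h : aut) : aut_fun g =1 aut_fun h -> g = h.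
Proof.
case: g h => [f f' fK f'K fa] [k k' kK k'K ka] /= /funext fk.
subst k; have f'k' : f' = k' by apply/funext => x; rewrite -[x in LHS]k'K fK.
by subst k'; congr Aut; exact: Prop_irrelevance.
Qed.

Definition aut_one : aut :=
  @Aut id id (fun=> erefl) (fun=> erefl) (fun _ _ => iff_refl _).

Lemma aut_inv_adj (g : aut) x y :
  adj G (aut_inv g x) (aut_inv g y) <-> adj G x y.
Proof. by rewrite -[adj G (aut_inv _ _) _](propext (aut_adj g _ _)) !aut_invK. Qed.

Definition aut_invg (g : aut) : aut :=
  Aut (aut_invK g) (aut_funK g) (aut_inv_adj g).

Lemma aut_comp_adj (g h : aut) x y :
  adj G ((g \o h) x) ((g \o h) y) <-> adj G x y.
Proof. exact: iff_trans (aut_adj g _ _) (aut_adj h _ _). Qed.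

Definition aut_mul (g h : aut) : aut :=
  Aut (can_comp (aut_funK g) (aut_funK h)) (can_comp (aut_invK h) (aut_invK g))
    (aut_comp_adj g h).

Lemma aut_mulA : associative aut_mul.
Proof. by move=> g h k; exact: aut_eq. Qed.

Lemma aut_1mul : left_id aut_one aut_mul.
Proof. by move=> g; exact: aut_eq. Qed.

Lemma aut_mul1 : right_id aut_one aut_mul.
Proof. by move=> g; exact: aut_eq. Qed.

Lemma aut_Vmul : left_inverse aut_one aut_invg aut_mul.
Proof. by move=> g; apply: aut_eq => x; exact: aut_funK. Qed.

Lemma aut_mulV : right_inverse aut_one aut_invg aut_mul.
Proof. by move=> g; apply: aut_eq => x; exact: aut_invK. Qed.

HB.instance Definition _ := gen_eqMixin aut.
HB.instance Definition _ := gen_choiceMixin aut.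
HB.instance Definition _ :=
  isGroup.Build aut aut_mulA aut_1mul aut_mul1 aut_Vmul aut_mulV.

(* The topology of pointwise convergence, V being discrete. *)
HB.instance Definition _ := Topological.copy aut
  (initial_topology (fun g : aut => aut_fun g : {ptws V -> discrete_topology V})).

Definition subgroup (Gamma : set aut) :=
  [/\ Gamma 1%g, (forall g h, Gamma g -> Gamma h -> Gamma (g * h)%g)
    & forall g, Gamma g -> Gamma (g^-1)%g].

Definition vertex_transitive (Gamma : set aut) :=
  forall x y : V, exists2 g, Gamma g & g x = y.

Definition stab_orbit (Gamma : set aut) (x y : V) : set V :=
  [set g y | g in [set g : aut | Gamma g /\ g x = x]].

(* w^y(x); note the order of the arguments. Both orbits are finite when G is
   connected and locally finite. *)
Definition weight (R : realType) (Gamma : set aut) (y x : V) : R :=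
  (ncard (stab_orbit Gamma x y))%:R / (ncard (stab_orbit Gamma y x))%:R.

Definition w_amenable (R : realType) (Gamma : set aut) (o : V) : Prop :=
  inf [set (\sum_(x \in vertex_boundary (adj G) F) weight R Gamma o x)
             / (\sum_(x \in F) weight R Gamma o x)
      | F in [set F : set V | finite_set F /\ F !=set0]] = 0.

End Automorphisms.

Section Subgraphs.
Variables (V : choiceType) (G : graph V).

Record subgraph := Subgraph {
  vertices : set V;
  edges : V -> V -> Prop;
  edges_sym : forall x y, edges x y -> edges y x;
  edges_adj : forall x y, edges x y -> adj G x y;
  edges_vertices : forall x y, edges x y -> vertices x }.

Definition full_subgraph : subgraph :=
  @Subgraph setT (adj G) (@adj_sym _ G) (fun _ _ => id) (fun _ _ _ => I).

HB.instance Definition _ := gen_eqMixin subgraph.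
HB.instance Definition _ := gen_choiceMixin subgraph.
HB.instance Definition _ := isPointed.Build subgraph full_subgraph.

Section Induced.
Variables (H : subgraph) (S : set V).

Definition induced_edges x y := [/\ edges H x y, S x & S y].

Lemma induced_sym x y : induced_edges x y -> induced_edges y x.
Proof. by case=> /edges_sym. Qed.

Lemma induced_adj x y : induced_edges x y -> adj G x y.
Proof. by case=> /edges_adj. Qed.

Lemma induced_vertices x y : induced_edges x y -> (vertices H `&` S) x.
Proof. by case=> /edges_vertices. Qed.

Definition induced : subgraph :=
  Subgraph induced_sym induced_adj induced_vertices.

End Induced.

(* Meaningful only when x is a vertex of H. *)
Definition comp_set (H : subgraph) (x : V) : set V :=
  [set y | clos_refl_trans V (edges H) x y].

Definition component (H : subgraph) (x : V) : subgraph :=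
  induced H (comp_set H x).

Definition amenable (R : realType) (H : subgraph) : Prop :=
  inf [set ((ncard (vertex_boundary (edges H) K))%:R / (ncard K)%:R : R)
      | K in [set K : set V | [/\ K `<=` vertices H, finite_set K & K !=set0]]]
  = 0.

Section Levels.
Variables (R : realType) (Gamma : set (aut G)).

Definition level (x : V) : set V := [set y | weight R Gamma x y = 1].

(* A finite union of levels is given by a finite set X of representatives. *)
Definition slice (X : set V) : subgraph :=
  induced full_subgraph (\bigcup_(x in X) level x).

Definition level_amenable : Prop :=
  forall X : set V, finite_set X ->
  forall x, vertices (slice X) x -> amenable R (component (slice X) x).

End Levels.

Section Action.
Variables (g : aut G) (H : subgraph).

Definition act_edges x y :=
  exists u v, [/\ edges H u v, g u = x & g v = y].

Lemma act_sym x y : act_edges x y -> act_edges y x.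
Proof. by move=> [u [v [/edges_sym ? <- <-]]]; exists v, u. Qed.

Lemma act_adj x y : act_edges x y -> adj G x y.
Proof. by move=> [u [v [/edges_adj ? <- <-]]]; apply/aut_adj. Qed.

Lemma act_vertices x y : act_edges x y -> [set g u | u in vertices H] x.
Proof. by move=> [u [v [/edges_vertices ? <- _]]]; exists u. Qed.

Definition subgraph_act : subgraph := Subgraph act_sym act_adj act_vertices.

End Action.

Definition subgraph_cylinders : set (set subgraph) :=
  range (fun x => [set H | vertices H x]) `|`
  range (fun p => [set H | edges H p.1 p.2]).

Definition configuration := g_sigma_algebraType subgraph_cylinders.

End Subgraphs.

Definition seq_cylinders d (T : measurableType d) : set (set (nat -> T)) :=
  [set C | exists n (A : set T), measurable A /\ C = [set u | A (u n)]].

Section Hyperfiniteness.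
Variables (V : choiceType) (G : graph V) (Gamma : set (aut G)) (R : realType).

Definition joint_configuration : Type :=
  (configuration G * g_sigma_algebraType (@seq_cylinders _ (configuration G)))%type.

Definition joint_act (g : aut G) (c : joint_configuration)
    : joint_configuration :=
  (subgraph_act g c.1, fun n => subgraph_act g (c.2 n)).

Definition hyperfinite_exhaustion d (Omega : measurableType d)
    (P : probability Omega R) (omega : {mfun Omega >-> configuration G})
    (omega_ : nat -> {mfun Omega >-> configuration G}) : Prop :=
  let joint w : joint_configuration := (omega w, fun n => omega_ n w) in
  [/\ forall n w, vertices (omega_ n w) `<=` vertices (omega_ n.+1 w) /\
        forall x y, edges (omega_ n w) x y -> edges (omega_ n.+1 w) x y,
      forall w, \bigcup_n vertices (omega_ n w) = vertices (omega w) /\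
        forall x y, (exists n, edges (omega_ n w) x y) <-> edges (omega w) x y,
      forall g, Gamma g -> forall A : set joint_configuration, measurable A ->
        pushforward P (joint_act g \o joint) A = pushforward P joint A
    & forall n, {ae P, forall w, forall x, vertices (omega_ n w) x ->
        finite_set (comp_set (omega_ n w) x)}].

(* The sequence omega_ may live on any probability space: only its joint law
   with omega matters. *)
Definition hyperfinite : Prop :=
  exists (d : measure_display) (Omega : measurableType d)
    (P : probability Omega R) (omega_ : nat -> {mfun Omega >-> configuration G}),
    @hyperfinite_exhaustion d Omega P (cst (full_subgraph G)) omega_.

End Hyperfiniteness.

(* Main.v *)
(* Write W for w^o. Counting orbits of pairs gives the cocycle identity for W
   and, for finite K, that the number of Gamma-translates K' of K with o in K'
   (resp. o in the boundary of K') equals c W(K) (resp. c W(boundary of K)) with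
   the same constant c.

   Weighted => level: average the boundary of a Folner set F over all
   translates of a component C of a slice; weights are comparable on each
   translate and each vertex lies in boundedly many of them.

   Level => weighted: the set of values of W on balls around o has polynomial
   growth, hence a Folner ball B. In a component of the slice of the levels in
   B, almost invariant finite sets K have almost the same weight in each level,
   so that the part of K near the boundary of B is small.

   Hyperfinite => weighted: let q(K) be the probability that K is a cluster of
   omega_n. By mass transport, the probability that o is on the boundary of its
   cluster, which tends to 0, is the q-average of W(inner boundary)/W.

   Weighted => hyperfinite: select each translate of a Folner set F_m
   independently with a suitable probability 2^-k, and delete the edges at
   vertices which are on the boundary of a selected translate or not covered by
   any; the clusters are then contained in translates of F_m. By Borel-Cantelli
   each vertex is affected by finitely many m only. *)
From HB Require Import structures.
From Stdlib Require Import Relation_Operators Operators_Properties.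
Require Import Defs.
From mathcomp Require Import all_boot all_order all_algebra finmap ring lra zify.
From mathcomp Require Import all_classical all_reals all_analysis.

Set Implicit Arguments.
Unset Strict Implicit.
Unset Printing Implicit Defensive.

Import Order.TTheory GRing.Theory Num.Theory.

Local Open Scope classical_set_scope.
Local Open Scope ring_scope.

(** * Finite sums, double counting and orbits *)

Section FiniteSums.
Context {R : numDomainType}.
Implicit Types (I J : choiceType).

Lemma ncard_sum I (A : set I) : (ncard A)%:R = \sum_(x \in A) (1 : R).
Proof.
rewrite /ncard; case: (pselect (finite_set A)) => [fA|nfA].
  by rewrite fsbig_finite//= card_fset_sum1 natr_sum.
(* For infinite [A] both sides are 0: [fset_set A] defaults to the empty set, and a sum of infinite
   support to 0. *)
rewrite fsbig_dflt /= /fset_set; first by case: pselect.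
apply: contra_not nfA; apply: sub_finite_set => x Ax; split=> //=.
by apply/eqP; rewrite oner_eq0.
Qed.

Lemma ler_fsum I (A : set I) (F H : I -> R) : finite_set A ->
  (forall x, A x -> F x <= H x) -> \sum_(x \in A) F x <= \sum_(x \in A) H x.
Proof.
move=> fA FH; rewrite !fsbig_finite//= big_seq [leRHS]big_seq.
by apply: ler_sum => x; rewrite in_fset_set// inE; exact: FH.
Qed.

Lemma ler_fsum_sub I (A B : set I) (F : I -> R) : finite_set B -> A `<=` B ->
  (forall x, B x -> 0 <= F x) -> \sum_(x \in A) F x <= \sum_(x \in B) F x.
Proof.
move=> fB AB F0; rewrite -(setIidr AB) fsbig_mkcondr.
by apply: ler_fsum => // x Bx; case: ifP => // _; exact: F0.
Qed.

Lemma exchange_fsum_dep I J (A : set I) (B : set J) (P : I -> J -> Prop)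
    (F : I -> J -> R) : finite_set A -> finite_set B ->
  \sum_(a \in A) \sum_(b \in B `&` [set b | P a b]) F a b =
  \sum_(b \in B) \sum_(a \in A `&` [set a | P a b]) F a b.
Proof.
move=> fA fB; under eq_fsbigr do rewrite fsbig_mkcondr.
rewrite exchange_fsbig//; apply: eq_fsbigr => b _.
rewrite fsbig_mkcondr; apply: eq_fsbigr => a _.
by congr (if _ then _ else _); apply/idP/idP; rewrite !inE.
Qed.

Lemma fsum_const I (A : set I) (c : R) :
  \sum_(x \in A) c = (ncard A)%:R * c.
Proof. by rewrite ncard_sum mulr_fsuml; under [RHS]eq_fsbigr do rewrite mul1r. Qed.

End FiniteSums.

Section FiniteCardinals.
Implicit Types (I J : choiceType).

Lemma ncard_gt0 I (A : set I) : finite_set A -> A !=set0 -> (0 < ncard A)%N.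
Proof.
move=> fA [x Ax]; rewrite /ncard cardfs_gt0; apply/fset0Pn; exists x.
by rewrite in_fset_set// inE.
Qed.

Lemma ncard_image I J (h : I -> J) (A : set I) : injective h ->
  ncard (h @` A) = ncard A.
Proof.
move=> hI; apply/eqP; rewrite -(eqr_nat rat) !ncard_sum fsbig_image//.
by move=> x y _ _; exact: hI.
Qed.

Lemma ncard_le I (A B : set I) : finite_set B -> A `<=` B ->
  (ncard A <= ncard B)%N.
Proof. by move=> fB AB; rewrite -(ler_nat rat) !ncard_sum ler_fsum_sub. Qed.

(** Both bounds estimate the number of pairs satisfying [P], counted once by rows and once by
    columns. *)
Lemma double_count_le I J (A : set I) (B : set J) (P : I -> J -> Prop) m n :
  finite_set A -> finite_set B ->
  (forall a, A a -> (m <= ncard (B `&` [set b | P a b]))%N) ->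
  (forall b, B b -> (ncard (A `&` [set a | P a b]) <= n)%N) ->
  (ncard A * m <= ncard B * n)%N.
Proof.
move=> fA fB mP nP; rewrite -(ler_nat rat) !natrM -!fsum_const.
apply: (@le_trans _ _ (\sum_(a \in A) \sum_(b \in B `&` [set b | P a b]) (1 : rat))).
  by apply: ler_fsum => // a Aa; rewrite -ncard_sum ler_nat; exact: mP.
rewrite exchange_fsum_dep//.
by apply: ler_fsum => // b Bb; rewrite -ncard_sum ler_nat; exact: nP.
Qed.

Lemma double_count I J (A : set I) (B : set J) (P : I -> J -> Prop) m n :
  finite_set A -> finite_set B ->
  (forall a, A a -> ncard (B `&` [set b | P a b]) = m) ->
  (forall b, B b -> ncard (A `&` [set a | P a b]) = n) ->
  (ncard A * m = ncard B * n)%N.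
Proof.
move=> fA fB mP nP; apply/eqP; rewrite eqn_leq; apply/andP; split.
  by apply: (double_count_le (P := P) fA fB) => [a /mP ->|b /nP ->].
by apply: (double_count_le (P := fun b a => P a b) fB fA) => [b /nP ->|a /mP ->].
Qed.

Lemma finite_subsets I (U : set I) : finite_set U -> finite_set [set L | L `<=` U].
Proof.
move=> fU; have : finite_set [set [set` L] | L in [set` fpowerset (fset_set U)]].
  exact/finite_image/finite_fset.
apply: sub_finite_set => L LU; have fL := sub_finite_set LU fU.
exists (fset_set L); last exact: fset_setK.
by rewrite /= fpowersetE -fset_set_sub.
Qed.

Lemma finite_uniform_bound I (A : set I) (Q : I -> nat -> Prop) :
  finite_set A -> (forall x m n, (m <= n)%N -> Q x m -> Q x n) ->
  (forall x, A x -> exists n, Q x n) -> exists n, forall x, A x -> Q x n.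
Proof.
move=> fA mQ exQ.
have /choice[f fP] : forall x, exists n, A x -> Q x n.
  move=> x; have [/exQ[n Qn]|nAx] := pselect (A x); first by exists n.
  by exists 0%N.
exists (\max_(x <- fset_set A) f x)%N => x Ax; apply: mQ (fP x Ax).
by apply: leq_bigmax_seq => //; rewrite in_fset_set// inE.
Qed.

End FiniteCardinals.

(** * Orbit counting for iterated stabilizers *)

Section Orbits.
Variables (V : choiceType) (G : graph V).

(** The whole automorphism group acts and the subgroup [D] is a separate argument of [orbit] and
    [stab], so that stabilizers can be taken repeatedly and the same lemmas serve vertices, sets and
    finite sets. *)
Record action (X : Type) := Action {
  act :> aut G -> X -> X;
  act1 : forall a, act 1%g a = a;
  actM : forall g h a, act (g * h)%g a = act g (act h a) }.

Definition vertex_action : action V :=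
  @Action V (@aut_fun V G) (fun _ => erefl) (fun _ _ _ => erefl).

Lemma image_act1 X (t : action X) (A : set X) : [set t 1%g x | x in A] = A.
Proof. by rewrite (eq_imagel (f' := id)) ?image_id// => x _; exact: act1. Qed.

Lemma image_actM X (t : action X) (g h : aut G) (A : set X) :
  [set t (g * h)%g x | x in A] = t g @` (t h @` A).
Proof. by rewrite image_comp; apply: eq_imagel => x _; exact: actM. Qed.

Definition set_action X (t : action X) : action (set X) :=
  Action (act := fun g A => t g @` A) (image_act1 t) (image_actM t).

Definition orbit X (t : action X) (D : set (aut G)) (a : X) : set X :=
  [set t g a | g in D].

Definition stab X (t : action X) (D : set (aut G)) (a : X) : set (aut G) :=
  [set g | D g /\ t g a = a].

Section Action.
Variables (X : choiceType) (t : action X).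

Lemma actK g : cancel (t g) (t g^-1%g).
Proof. by move=> a; rewrite -actM mulVg act1. Qed.

Lemma actVK g : cancel (t g^-1%g) (t g).
Proof. by move=> a; rewrite -actM mulgV act1. Qed.

Lemma act_inj g : injective (t g).
Proof. exact: can_inj (actK g). Qed.

Variable D : set (aut G).
Hypothesis subD : subgroup D.

Lemma sub1 : D 1%g. Proof. by case: subD. Qed.
Lemma subM g h : D g -> D h -> D (g * h)%g. Proof. by case: subD => _ + _; exact. Qed.
Lemma subV g : D g -> D g^-1%g. Proof. by case: subD => _ _; exact. Qed.

Lemma stab_subgroup a : subgroup (stab t D a).
Proof.
split; first by split; [exact: sub1|exact: act1].
- by move=> g h [Dg ga] [Dh ha]; split; [exact: subM|rewrite actM ha ga].
- by move=> g [Dg ga]; split; [exact: subV|rewrite -[in LHS]ga actK].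
Qed.

Lemma orbit_refl a : orbit t D a a.
Proof. by exists 1%g; [exact: sub1|exact: act1]. Qed.

Lemma orbit_act g a : D g -> orbit t D (t g a) = orbit t D a.
Proof.
move=> Dg; apply/seteqP; split=> _ [h Dh <-].
  by exists (h * g)%g; [exact: subM|rewrite actM].
by exists (h * g^-1)%g; [exact: subM Dh (subV Dg)|rewrite actM actK].
Qed.

Lemma stab_act g a : D g ->
  stab t D (t g a) = [set (g * h * g^-1)%g | h in stab t D a].
Proof.
move=> Dg; apply/seteqP; split=> [h [Dh hga]|_ [h [Dh ha] <-]].
  exists (g^-1 * h * g)%g; last by rewrite !mulgA mulgV mul1g -mulgA mulgV mulg1.
  by split; [exact: subM (subM (subV Dg) Dh) Dg|rewrite !actM hga actK].
split; first exact: subM (subM Dg Dh) (subV Dg).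
by rewrite !actM actK ha.
Qed.

End Action.

Section TwoActions.
Variables (X Y : choiceType) (s : action X) (t : action Y) (D : set (aut G)).
Hypothesis subD : subgroup D.

Lemma orbit_stab_act g a b : D g ->
  orbit t (stab s D (s g a)) (t g b) = t g @` orbit t (stab s D a) b.
Proof.
move=> Dg; rewrite stab_act//; apply/seteqP; split.
  by move=> _ [_ [h [Dh ha] <-] <-]; exists (t h b); [exists h|rewrite !actM actK].
move=> _ [_ [h [Dh ha] <-] <-]; exists (g * h * g^-1)%g; first by exists h.
by rewrite !actM actK.
Qed.

Lemma ncard_orbit_stab_act g a b : D g ->
  ncard (orbit t (stab s D (s g a)) (t g b)) = ncard (orbit t (stab s D a) b).
Proof. by move=> Dg; rewrite orbit_stab_act// ncard_image//; exact: act_inj. Qed.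

(** The [h] in [D] that agree with [g] on [a] form the coset of [stab s D a] by [g]. *)
Lemma orbit_fiber g a b : D g ->
  [set b' | exists h, [/\ D h, s h a = s g a & t h b = b']] =
  t g @` orbit t (stab s D a) b.
Proof.
move=> Dg; apply/seteqP; split=> [_ [h [Dh ha <-]]|_ [_ [h [Dh ha] <-] <-]].
  exists (t (g^-1 * h)%g b); last by rewrite -actM mulgA mulgV mul1g.
  exists (g^-1 * h)%g => //; split; first exact: (subM subD (subV subD Dg) Dh).
  by rewrite actM ha actK.
by exists (g * h)%g; rewrite !actM ha; split=> //; exact: subM.
Qed.

End TwoActions.

(* Both sides count the orbit of the pair [(a, b)]. *)
Lemma orbit_pair (X Y : choiceType) (s : action X) (t : action Y)
    (D : set (aut G)) a b : subgroup D ->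
  finite_set (orbit s D a) -> finite_set (orbit t D b) ->
  (ncard (orbit s D a) * ncard (orbit t (stab s D a) b) =
   ncard (orbit t D b) * ncard (orbit s (stab t D b) a))%N.
Proof.
move=> subD fa fb.
apply: (double_count fa fb
  (P := fun a' b' => exists h, [/\ D h, s h a = a' & t h b = b'])).
- move=> _ [g Dg <-]; rewrite setIidr.
    by rewrite orbit_fiber// ncard_image//; exact: act_inj.
  by move=> _ [h [Dh _ <-]]; exists h.
- move=> _ [g Dg <-]; rewrite setIidr.
    rewrite -[in RHS](ncard_image _ (act_inj (t := s) (g := g))).
    rewrite -orbit_fiber//; congr ncard; apply/seteqP.
    by split=> a' [h []]; exists h.
  by move=> _ [h [Dh <- _]]; exists h.
Qed.

End Orbits.

(** * Balls and the relative weight *)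

Section Balls.
Variables (V : choiceType) (G : graph V).

Definition neighbors (A : set V) : set V := [set y | exists2 x, A x & adj G x y].

Fixpoint ball (A : set V) n : set V :=
  if n is m.+1 then ball A m `|` neighbors (ball A m) else A.

Lemma vertex_boundaryE (F : set V) :
  vertex_boundary (adj G) F = neighbors F `\` F.
Proof. by apply/seteqP; split=> y []. Qed.

Lemma neighbors_image (g : aut G) A : neighbors (g @` A) = g @` neighbors A.
Proof.
apply/seteqP; split=> [y [_ [x Ax <-]]|_ [y [x Ax xy] <-]].
  rewrite -[y](aut_invK g) => /aut_adj xy; exists (aut_inv g y) => //.
  by exists x.
by exists (g x); [exists x|apply/aut_adj].
Qed.

Lemma ball_image (g : aut G) A n : ball (g @` A) n = g @` ball A n.
Proof. by elim: n => //= n ->; rewrite neighbors_image image_setU. Qed.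

Lemma ball_subset A B n : A `<=` B -> ball A n `<=` ball B n.
Proof.
move=> AB; elim: n => //= n IH; apply: setUSS => // y [x /IH Bx xy].
by exists x.
Qed.

Lemma subset_ball A m n : (m <= n)%N -> ball A m `<=` ball A n.
Proof.
elim: n => [|n IH]; first by rewrite leqn0 => /eqP ->.
by rewrite leq_eqVlt => /predU1P[->//|/IH mn x /mn]; left.
Qed.

Hypothesis connG : connected_graph G.
Hypothesis lfG : locally_finite G.

Lemma ball_cover x y : exists n, ball [set x] n y.
Proof.
elim: (clos_rt_rtn1 _ _ _ _ (connG x y)) => [|y' z yz _ [n xy']]; first by exists 0%N.
by exists n.+1; right; exists y'.
Qed.

Lemma neighbors_finite A : finite_set A -> finite_set (neighbors A).
Proof.
move=> fA; have -> : neighbors A = \bigcup_(x in A) [set y | adj G x y].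
  by apply/seteqP; split=> y [x]; exists x.
by apply: bigcup_finite => // x _; exact: lfG.
Qed.

Lemma ball_finite A n : finite_set A -> finite_set (ball A n).
Proof.
move=> fA; elim: n => //= n IH; rewrite finite_setU; split=> //.
exact: neighbors_finite.
Qed.

Lemma boundary_finite F : finite_set F -> finite_set (vertex_boundary (adj G) F).
Proof.
by rewrite vertex_boundaryE => fF; apply: finite_setD; exact: neighbors_finite.
Qed.

Lemma vertices_countable (x : V) : countable [set: V].
Proof.
have -> : [set: V] = \bigcup_n ball [set x] n.
  by apply/seteqP; split=> // y _; have [n] := ball_cover x y; exists n.
apply: bigcup_countable => // n _; apply: finite_set_countable.
exact/ball_finite/finite_set1.
Qed.

End Balls.

(** * The cocycle identity *)

Section Weights.
Variables (R : realType) (V : choiceType) (G : graph V) (Gamma : set (aut G)).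
Hypothesis connG : connected_graph G.
Hypothesis lfG : locally_finite G.
Hypothesis subG : subgroup Gamma.

Local Notation va := (vertex_action G).

(** An element fixing [K] setwise sends [k] into [K], so the image of [y] stays within a fixed
    distance of [K]. *)
Lemma orbit_stab_finite (K : set V) y : finite_set K -> K !=set0 ->
  finite_set (orbit va (stab (set_action va) Gamma K) y).
Proof.
move=> fK [k Kk]; have [n ky] := ball_cover connG k y.
apply: (@sub_finite_set _ _ (ball G K n)); last exact: ball_finite.
move=> _ [g [_ gK] <-]; apply: (@ball_subset _ _ [set g k]).
  by move=> _ ->; rewrite -gK; exists k.
by rewrite -image_set1 ball_image; exists y.
Qed.

Lemma stab_set1 x : stab (set_action va) Gamma [set x] = stab va Gamma x.
Proof.
apply/seteqP; split=> g [Gg gx]; split=> //.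
  have : [set x] (g x) by rewrite -gx; exists x.
  by [].
by rewrite /= image_set1 (_ : g x = x).
Qed.

Lemma stab_orbit_finite x y : finite_set (orbit va (stab va Gamma x) y).
Proof.
by rewrite -stab_set1; apply: orbit_stab_finite; [exact: finite_set1|exists x].
Qed.

Lemma stab_orbit_set_finite x (K : set V) : finite_set K ->
  finite_set (orbit (set_action va) (stab va Gamma x) K).
Proof.
move=> fK; pose U := \bigcup_(y in K) orbit va (stab va Gamma x) y.
have fU : finite_set U by apply: bigcup_finite => // y _; exact: stab_orbit_finite.
apply: (@sub_finite_set _ _ [set L | L `<=` U]).
  by move=> _ [g gx <-] _ [y Ky <-]; exists y => //; exists g.
exact: finite_subsets.
Qed.

Section Ratio.
Variables (X : choiceType) (t : action G X).

(** The relative weight with the second vertex replaced by a point [a] of any action. For a finite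
    set [a], it is the constant in the count of translates of [a] through a vertex. *)
Definition ratio (x : V) (a : X) : R :=
  (ncard (orbit t (stab va Gamma x) a))%:R / (ncard (orbit va (stab t Gamma a) x))%:R.

Variable a : X.
Hypothesis fin_l : forall x, finite_set (orbit t (stab va Gamma x) a).
Hypothesis fin_r : forall x, finite_set (orbit va (stab t Gamma a) x).

Lemma ncard_orbit_gt0 (Y : choiceType) (s : action G Y) D b : subgroup D ->
  finite_set (orbit s D b) -> (0 < ncard (orbit s D b))%N.
Proof. by move=> sD fb; apply: ncard_gt0 => //; exists b; exact: orbit_refl. Qed.

Lemma stabC (Y Z : Type) (s : action G Y) (u : action G Z) D b c :
  stab s (stab u D b) c = stab u (stab s D c) b.
Proof. by apply/seteqP; split=> g [[Dg ga] gb]. Qed.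

Lemma ratio_gt0 x : 0 < ratio x a.
Proof.
by apply: divr_gt0; rewrite ltr0n ncard_orbit_gt0//; apply: stab_subgroup.
Qed.

(** [orbit_pair] is applied to the stabilizers of [x], of [y] and of [a], each acting on the other
    two points. The orbits under stabilizers of two points then cancel. *)
Lemma ratio_cocycle x y : ratio x a = weight R Gamma y x * ratio y a.
Proof.
have sx := stab_subgroup va subG x; have sy := stab_subgroup va subG y.
have sa := stab_subgroup t subG a.
have := orbit_pair (s := t) (t := va) sx (fin_l x) (stab_orbit_finite x y).
have := orbit_pair (s := t) (t := va) sy (fin_l y) (stab_orbit_finite y x).
have := orbit_pair (s := va) (t := va) sa (fin_r x) (fin_r y).
rewrite (stabC va va _ x y) (stabC t va _ x a) (stabC t va _ y a).
rewrite /ratio -/(orbit va (stab va Gamma x) y).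
rewrite /weight -/(orbit va (stab va Gamma x) y) -/(orbit va (stab va Gamma y) x).
have sub2 : finite_set (orbit va (stab va (stab t Gamma a) x) y).
  by apply: sub_finite_set (fin_r y) => _ [g [? _] <-]; exists g.
have sub3 : finite_set (orbit va (stab va (stab t Gamma a) y) x).
  by apply: sub_finite_set (fin_r x) => _ [g [? _] <-]; exists g.
have := ncard_orbit_gt0 (stab_subgroup va sa x) sub2.
have := ncard_orbit_gt0 (stab_subgroup va sa y) sub3.
have := ncard_orbit_gt0 sa (fin_r y); have := ncard_orbit_gt0 sa (fin_r x).
have := ncard_orbit_gt0 sy (stab_orbit_finite y x).
move: (ncard (orbit va (stab va (stab t Gamma a) x) y)) => p.
move: (ncard (orbit va (stab va (stab t Gamma a) y) x)) => r.
move: (ncard (orbit t (stab va (stab va Gamma y) x) a)) => q.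
move: (ncard (orbit t (stab va Gamma x) a)) => a1.
move: (ncard (orbit t (stab va Gamma y) a)) => a2.
move: (ncard (orbit va (stab t Gamma a) x)) => b1.
move: (ncard (orbit va (stab t Gamma a) y)) => b2.
move: (ncard (orbit va (stab va Gamma x) y)) => c.
move: (ncard (orbit va (stab va Gamma y) x)) => d.
rewrite -!(ltr0n R) => /lt0r_neq0 d0 /lt0r_neq0 b10 /lt0r_neq0 b20.
move=> /lt0r_neq0 r0 /lt0r_neq0 p0.
move=> /(congr1 (fun n => n%:R : R)); rewrite !natrM => e3.
move=> /(congr1 (fun n => n%:R : R)); rewrite !natrM => e2.
move=> /(congr1 (fun n => n%:R : R)); rewrite !natrM => e1.
rewrite mulf_div; apply/eqP; rewrite eqr_div ?mulf_neq0//; apply/eqP.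
apply: (@mulIf _ (p%:R * r%:R)); first exact: mulf_neq0.
transitivity ((a1%:R * p%:R) * (d%:R * (b2%:R * r%:R)) : R); first by ring.
transitivity ((c%:R * (a2%:R * r%:R)) * (b1%:R * p%:R) : R); last by ring.
by rewrite e1 e2 e3; ring.
Qed.

End Ratio.

Lemma weightE x y : weight R Gamma y x = ratio va x y.
Proof. by []. Qed.

Lemma weight_gt0 x y : 0 < weight R Gamma y x.
Proof. by rewrite weightE; apply: ratio_gt0; move=> *; exact: stab_orbit_finite. Qed.

Lemma weight_cocycle x y z :
  weight R Gamma z x = weight R Gamma y x * weight R Gamma z y.
Proof. by rewrite !weightE; apply: ratio_cocycle; move=> *; exact: stab_orbit_finite. Qed.

Lemma weightxx x : weight R Gamma x x = 1.
Proof.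
by apply: (mulfI (lt0r_neq0 (weight_gt0 x x))); rewrite mulr1 -weight_cocycle.
Qed.

Lemma weight_act g x y : Gamma g -> weight R Gamma (g y) (g x) = weight R Gamma y x.
Proof.
move=> Gg; congr (_%:R / _%:R).
  exact: (ncard_orbit_stab_act va va subG x y Gg).
exact: (ncard_orbit_stab_act va va subG y x Gg).
Qed.

Variable o : V.
Local Notation W := (weight R Gamma o).

Lemma weight_image g x : Gamma g -> W (g x) = W (g o) * W x.
Proof. by move=> Gg; rewrite (weight_cocycle _ (g o)) weight_act// mulrC. Qed.

Lemma weight_div x y : weight R Gamma x y = W y / W x.
Proof.
by rewrite (weight_cocycle y x o) mulfK// gt_eqF// weight_gt0.
Qed.

Lemma levelE x : level R Gamma x = [set y | W y = W x].
Proof.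
apply/seteqP; split=> y; rewrite /level /= (weight_div x y).
  by move=> /divr1_eq.
by move=> ->; rewrite divff// gt_eqF// weight_gt0.
Qed.

Hypothesis transG : vertex_transitive Gamma.

(** * Translates through a vertex *)

Section Counting.
(** [D] attaches a vertex set equivariantly to each point: a set itself, its inner boundary or its
    outer boundary. The factor [ratio t o a] obtained below is the same for all of them. *)
Variables (X : choiceType) (t : action G X) (D : X -> set V).
Hypothesis DE : forall g a, Gamma g -> D (t g a) = g @` D a.

Section Point.
Variable a : X.
Hypothesis fin_l : forall x, finite_set (orbit t (stab va Gamma x) a).
Hypothesis fin_r : forall x, finite_set (orbit va (stab t Gamma a) x).
Hypothesis fD : finite_set (D a).

Let S := orbit t Gamma a `&` [set a' | D a' o].
Let P x a' := exists h, [/\ Gamma h, h x = o & t h a = a'].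

Let fiberS x : D a x -> S `&` [set a' | P x a'] = [set a' | P x a'].
Proof.
move=> Dx; apply/setIidr => _ [h [Gh hx <-]]; split; first by exists h.
by rewrite /= DE// -hx; exists x.
Qed.

Let fiber_image x : exists2 g, Gamma g &
  [set a' | P x a'] = t g @` orbit t (stab va Gamma x) a.
Proof.
have [g Gg gx] := transG x o; exists g => //.
rewrite -(orbit_fiber va t subG x a Gg).
by apply/seteqP; split=> a' [h]; rewrite /= gx; exists h.
Qed.

Lemma orbit_through_finite : finite_set S.
Proof.
apply: (@sub_finite_set _ _ (\bigcup_(x in D a) [set a' | P x a'])).
  move=> _ [[g Gg <-]]; rewrite /= DE// => -[x Dx gx].
  by exists x => //; exists g.
apply: bigcup_finite => // x _; have [g _ ->] := fiber_image x.
exact: finite_image.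
Qed.

(* Weight each pair [(x, a')] with [g x = o], [g a = a'] by [1 / |Gamma_a x|]. *)
Lemma ncard_orbit_through :
  (ncard S)%:R = ratio t o a * \sum_(x \in D a) W x.
Proof.
rewrite mulr_fsumr ncard_sum.
under [RHS]eq_fsbigr do rewrite mulrC -ratio_cocycle//.
transitivity (\sum_(a' \in S) \sum_(x \in D a `&` [set x | P x a'])
    ((ncard (orbit va (stab t Gamma a) x))%:R^-1 : R)).
  apply: eq_fsbigr => a'; rewrite inE => -[[g Gg <-{a'}]].
  rewrite /= DE// => -[x Dx gx].
  have sa := stab_subgroup t subG a.
  (* The preimages of [o] form a single orbit of the stabilizer of [a], so that the weights of the
     pairs over one translate add up to 1. *)
  have -> : D a `&` [set x | P x (t g a)] = orbit va (stab t Gamma a) x.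
    apply/seteqP; split=> [y [_ [h [Gh hy ha]]]|_ [h [Gh ha] <-]].
      exists (h^-1 * g)%g; first split.
      - exact: (subM subG (subV subG Gh)).
      - by rewrite actM -ha actK.
      - by rewrite actM /= gx -hy; exact: aut_funK.
    split.
      by rewrite -ha DE//; exists x.
    exists (g * h^-1)%g; split.
    - exact: (subM subG Gg (subV subG Gh)).
    - by rewrite /= aut_funK.
    - by rewrite actM -[in LHS]ha actK.
  transitivity (\sum_(y \in orbit va (stab t Gamma a) x)
    ((ncard (orbit va (stab t Gamma a) x))%:R^-1 : R)).
    rewrite fsum_const divff// pnatr_eq0 -lt0n.
    exact: ncard_orbit_gt0.
  by apply: eq_fsbigr => _ /set_mem[h ha <-]; rewrite orbit_act.
rewrite -(exchange_fsum_dep _ _ fD orbit_through_finite).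
apply: eq_fsbigr => x; rewrite inE => Dx.
rewrite fiberS// fsum_const; congr (_%:R * _).
by have [g _ ->] := fiber_image x; rewrite ncard_image//; exact: act_inj.
Qed.

End Point.
End Counting.

Section MassTransport.
Variables (X : choiceType) (t : action G X) (D1 D2 : X -> set V).
Hypothesis D1E : forall g a, Gamma g -> D1 (t g a) = g @` D1 a.
Hypothesis D2E : forall g a, Gamma g -> D2 (t g a) = g @` D2 a.
Hypothesis D21 : forall a, D2 a `<=` D1 a.
Variables (S : set X) (Q : X -> R).
Hypothesis fS : finite_set S.
Hypothesis SD : forall a, S a -> D1 a o.
Hypothesis S_closed : forall a g, S a -> Gamma g -> D1 (t g a) o -> S (t g a).
Hypothesis fin_l : forall a x, S a -> finite_set (orbit t (stab va Gamma x) a).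
Hypothesis fin_r : forall a x, S a -> finite_set (orbit va (stab t Gamma a) x).
Hypothesis fD : forall a, S a -> finite_set (D1 a).
Hypothesis QE : forall a g, S a -> Gamma g -> S (t g a) -> Q (t g a) = Q a.

(** Each [Q b] is spread evenly over the translates of [b] whose [D1] contains [o]; these lie in [S]
    and all carry the same [Q]. The share received where [D2] contains [o] is a quotient of two
    counts of translates, hence of two weights, as the common [ratio] cancels. *)
Lemma mass_transport :
  \sum_(a \in S `&` [set a | D2 a o]) Q a =
  \sum_(a \in S) Q a * ((\sum_(x \in D2 a) W x) / (\sum_(x \in D1 a) W x)).
Proof.
pose N1 a : R := (ncard (orbit t Gamma a `&` [set a' | D1 a' o]))%:R.
have SN a : S a -> orbit t Gamma a `&` [set a' | D1 a' o] =
    S `&` [set b | orbit t Gamma a b].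
  move=> Sa; apply/seteqP; split=> b.
    by move=> [[g Gg <-] ?]; split; [exact: S_closed|exists g].
  by move=> [Sb ?]; split=> //; exact: SD.
have N10 a : S a -> 0 < N1 a.
  move=> Sa; rewrite ltr0n ncard_gt0//.
    by rewrite SN//; exact: finite_setIl.
  by exists a; split; [exact: orbit_refl|exact: SD].
have symO a b : orbit t Gamma a b -> orbit t Gamma a = orbit t Gamma b.
  by move=> [g Gg <-]; rewrite orbit_act.
transitivity (\sum_(a \in S `&` [set a | D2 a o])
    \sum_(b \in S `&` [set b | orbit t Gamma a b]) (Q b / N1 b)).
  apply: eq_fsbigr => a; rewrite inE => -[Sa _].
  transitivity (\sum_(b \in S `&` [set b | orbit t Gamma a b]) (Q a / N1 a)).
    rewrite fsum_const -SN// -/(N1 a) mulrC divfK// gt_eqF//; exact: N10.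
  apply: eq_fsbigr => b; rewrite inE => -[Sb ab].
  rewrite /N1 (symO a b ab); by case: ab Sb => g Gg <- Sb; rewrite QE.
rewrite (exchange_fsum_dep (fun a b => orbit t Gamma a b))//; last exact: finite_setIl.
apply: eq_fsbigr => b; rewrite inE => Sb.
rewrite fsum_const mulrCA; congr (_ * _).
have -> : S `&` [set a | D2 a o] `&` [set a | orbit t Gamma a b] =
    orbit t Gamma b `&` [set a | D2 a o].
  apply/seteqP; split=> a.
    by move=> [[Sa Da] ab]; split=> //; rewrite -(symO a b ab); exact: orbit_refl.
  move=> [[g Gg <-] Da]; split; first split=> //.
    by apply: S_closed => //; exact: D21.
  by rewrite /= orbit_act//; exact: orbit_refl.
have fD2 : finite_set (D2 b) by apply: sub_finite_set (fD Sb); exact: D21.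
have fl x : finite_set (orbit t (stab va Gamma x) b) by exact: fin_l.
have fr x : finite_set (orbit va (stab t Gamma b) x) by exact: fin_r.
rewrite /N1 !ncard_orbit_through//; last exact: fD.
have r0 : ratio t o b != 0 by rewrite gt_eqF// ratio_gt0.
by rewrite -mulf_div divff// mul1r.
Qed.

End MassTransport.

End Weights.

(** * Amenability, components and slices *)

Section Amenability.
Variable R : realType.

Lemma inf_eq0P (A : set R) : A !=set0 -> (forall x, A x -> 0 <= x) ->
  inf A = 0 <-> forall e, 0 < e -> exists2 x, A x & x < e.
Proof.
move=> A0 Age0; have hA : has_inf A by split=> //; exists 0 => x /Age0.
split=> [i0 e e0|small].
  by have [x Ax] := inf_adherent e0 hA; rewrite i0 add0r; exists x.
apply/eqP; rewrite eq_le; apply/andP; split; last exact: lb_le_inf.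
rewrite leNgt; apply/negP => /small[x Ax]; apply/negP; rewrite -leNgt.
by apply: ge_inf => //; case: hA.
Qed.

Variables (V : choiceType) (G : graph V) (Gamma : set (aut G)).
Hypothesis connG : connected_graph G.
Hypothesis lfG : locally_finite G.

(** A vertex is required because the infimum of the empty set defaults to 0, while no set [K] would
    exist. *)
Lemma amenableP (H : subgraph G) : vertices H !=set0 ->
  amenable R H <-> forall e : R, 0 < e -> exists K : set V,
    [/\ K `<=` vertices H, finite_set K, K !=set0 &
      (ncard (vertex_boundary (edges H) K))%:R < e * (ncard K)%:R].
Proof.
move=> [x Hx]; rewrite /amenable inf_eq0P; last 2 first.
- eexists; exists [set x]; last reflexivity.
  by split=> [_ -> //||]; [exact: finite_set1|exists x].
- by move=> _ [K _ <-]; apply: divr_ge0.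
split=> small e /small.
  move=> [_ [K [KH fK K0] <-] Ke]; exists K; split=> //.
  by rewrite -ltr_pdivrMr// ltr0n ncard_gt0.
move=> [K [KH fK K0 Ke]]; eexists; first by exists K; [split|reflexivity].
by rewrite ltr_pdivrMr// ltr0n ncard_gt0.
Qed.

Hypothesis subG : subgroup Gamma.
Variable o : V.
Local Notation W := (weight R Gamma o).

Lemma sum_weight_gt0 (A : set V) : finite_set A -> A !=set0 ->
  0 < \sum_(x \in A) W x.
Proof.
move=> fA [x Ax]; apply: (@lt_le_trans _ _ (\sum_(y \in [set x]) W y)).
  by rewrite fsbig_set1; exact: weight_gt0.
apply: ler_fsum_sub => // [_ -> //|y _]; exact/ltW/weight_gt0.
Qed.

Lemma sum_weight_ge0 (A : set V) : 0 <= \sum_(x \in A) W x.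
Proof. by apply: fsumr_ge0 => x _; exact/ltW/weight_gt0. Qed.

Lemma w_amenableP :
  w_amenable R Gamma o <-> forall e : R, 0 < e -> exists F : set V,
    [/\ finite_set F, F !=set0 & \sum_(x \in vertex_boundary (adj G) F) W x <
      e * \sum_(x \in F) W x].
Proof.
rewrite /w_amenable inf_eq0P; last 2 first.
- by eexists; exists [set o]; [split; [exact: finite_set1|exists o]|reflexivity].
- by move=> _ [K _ <-]; apply: divr_ge0; exact: sum_weight_ge0.
split=> small e /small.
  move=> [_ [K [fK K0] <-] Ke]; exists K; split=> //.
  by rewrite -ltr_pdivrMr// sum_weight_gt0.
move=> [K [fK K0 Ke]]; eexists; first by exists K; [split|reflexivity].
by rewrite ltr_pdivrMr// sum_weight_gt0.
Qed.

End Amenability.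

(** * Components and their images *)

Section Components.
Variables (V : choiceType) (G : graph V).

Lemma comp_set_refl (H : subgraph G) x : comp_set H x x.
Proof. exact: rt_refl. Qed.

Lemma comp_set_step (H : subgraph G) x y z :
  comp_set H x y -> edges H y z -> comp_set H x z.
Proof. by move=> xy yz; apply: rt_trans xy _; exact: rt_step. Qed.

Lemma comp_set_sym (H : subgraph G) x y : comp_set H x y -> comp_set H y x.
Proof.
elim=> [u v /edges_sym uv|u|u v w _ vu _ wv].
- exact: rt_step.
- exact: rt_refl.
- exact: rt_trans wv vu.
Qed.

Lemma comp_set_eq (H : subgraph G) x y :
  comp_set H x y -> comp_set H x = comp_set H y.
Proof.
move=> xy; apply/seteqP; split=> z; last exact: rt_trans xy.
exact: rt_trans (comp_set_sym xy).
Qed.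

Lemma comp_set_image (H H' : subgraph G) (g : aut G) x :
  (forall u v, edges H' (g u) (g v) <-> edges H u v) ->
  comp_set H' (g x) = g @` comp_set H x.
Proof.
move=> gE; apply/seteqP; split=> [y|_ [y xy <-]].
  move=> xy; elim: (clos_rt_rtn1 _ _ _ _ xy) => [|u v uv _ [z xz zu]].
    by exists x => //; exact: rt_refl.
  exists (aut_inv g v); last by rewrite aut_invK.
  apply: (comp_set_step xz); apply/gE.
  by rewrite aut_invK zu.
elim: xy => [u v uv|u|u v w _ uv _ vw].
- by apply: rt_step; apply/gE.
- exact: rt_refl.
- exact: rt_trans uv vw.
Qed.

Lemma comp_set_act (H : subgraph G) (g : aut G) x :
  comp_set (subgraph_act g H) (g x) = g @` comp_set H x.
Proof.
apply: comp_set_image => u v; split=> [[u' [v' [uv gu gv]]]|]; last by exists u, v.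
by rewrite -(aut_funK g u) -(aut_funK g v) -gu -gv !aut_funK.
Qed.

End Components.

Section Slices.
Variables (R : realType) (V : choiceType) (G : graph V) (Gamma : set (aut G)).
Hypothesis connG : connected_graph G.
Hypothesis lfG : locally_finite G.
Hypothesis subG : subgroup Gamma.
Hypothesis transG : vertex_transitive Gamma.
Variable o : V.
Local Notation W := (weight R Gamma o).

Lemma slice_vertices (X : set V) :
  vertices (slice R Gamma X) = [set y | exists2 x, X x & W y = W x].
Proof.
apply/seteqP; split=> [y [_ [x Xx]]|y [x Xx yx]].
  by rewrite (levelE R connG lfG subG o); exists x.
by split=> //; exists x => //; rewrite (levelE R connG lfG subG o).
Qed.

Lemma slice_edges (X : set V) y z : edges (slice R Gamma X) y z =
  [/\ adj G y z, vertices (slice R Gamma X) y & vertices (slice R Gamma X) z].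
Proof. by apply/propext; split=> -[yz yX zX]; split=> //; [case: yX|case: zX]. Qed.

(** If [W (g o) = 1], then [g] preserves all weights, hence every level and every slice. *)
Lemma slice_image (X : set V) g y z : Gamma g -> W (g o) = 1 ->
  edges (slice R Gamma X) (g y) (g z) <-> edges (slice R Gamma X) y z.
Proof.
move=> Gg g1; rewrite !slice_edges !slice_vertices /=.
have Wg x : W (g x) = W x.
  by rewrite (weight_image R connG lfG subG o x Gg) g1 mul1r.
rewrite !Wg.
by split=> -[yz ? ?]; split=> //; apply/(aut_adj g).
Qed.

Section Averaging.
Variables (X : set V) (x0 : V).
Hypothesis fX : finite_set X.
Hypothesis Xx0 : vertices (slice R Gamma X) x0.

Let C := comp_set (slice R Gamma X) x0.
Let H := component (slice R Gamma X) x0.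

Lemma comp_slice_vertices y : C y -> exists2 x, X x & W y = W x.
Proof.
move=> xy; elim: (clos_rt_rtn1 _ _ _ _ xy) => [|u v].
  by move: Xx0; rewrite slice_vertices.
by rewrite slice_edges slice_vertices => -[].
Qed.

Lemma component_vertices : vertices H = C.
Proof.
apply/seteqP; split=> [y [] //|y Cy]; split=> //.
by rewrite slice_vertices; exact: comp_slice_vertices.
Qed.

Lemma component_edges y z : C y -> adj G y z ->
  (exists2 x, X x & W z = W x) -> edges H y z.
Proof.
move=> Cy yz Xz; have e : edges (slice R Gamma X) y z.
  by rewrite slice_edges slice_vertices; split=> //; exact: comp_slice_vertices.
by split=> //; exact: comp_set_step Cy e.
Qed.

(** By [slice_image], [g] permutes the components of the slice, so it fixes a component that meets
    its own image. *)
Lemma component_image g z : Gamma g -> W (g o) = 1 -> C z -> C (g z) -> g @` C = C.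
Proof.
move=> Gg g1 Cz Cgz; rewrite /C [in LHS](comp_set_eq Cz).
rewrite -(@comp_set_image _ _ _ (slice R Gamma X)); last first.
  by move=> u v; exact: slice_image.
by rewrite -(comp_set_eq Cgz).
Qed.

End Averaging.
End Slices.

(** * Weighted amenability implies level-amenability *)

Section FiniteBounds.
Context {R : realFieldType}.

Lemma fsum_ge_term (I : choiceType) (A : set I) (F : I -> R) x :
  finite_set A -> (forall y, A y -> 0 <= F y) -> A x -> F x <= \sum_(y \in A) F y.
Proof.
move=> fA F0 Ax; apply: le_trans (ler_fsum_sub (A := [set x]) fA _ F0).
  by rewrite fsbig_set1.
by move=> _ ->.
Qed.

Lemma finite_pos_lower_bound (I : choiceType) (A : set I) (F : I -> R) :
  finite_set A -> (forall y, A y -> 0 < F y) ->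
  exists2 m : R, 0 < m & forall y, A y -> m <= F y.
Proof.
move=> fA F0; have S0 : 0 <= \sum_(y \in A) (F y)^-1.
  by apply: fsumr_ge0 => y /F0 /ltW; rewrite invr_ge0.
have S1 : 0 < 1 + \sum_(y \in A) (F y)^-1 by lra.
exists (1 + \sum_(y \in A) (F y)^-1)^-1; first by rewrite invr_gt0.
move=> y Ay; rewrite -[leRHS]invrK lef_pV2 ?posrE ?invr_gt0 ?F0//.
apply: (@le_trans _ _ (\sum_(y \in A) (F y)^-1)); last lra.
by apply: (fsum_ge_term (F := fun y => (F y)^-1)) => // z /F0 /ltW; rewrite invr_ge0.
Qed.

Lemma finite_upper_bound (I : choiceType) (A : set I) (F : I -> R) :
  finite_set A -> exists2 M : R, 0 < M & forall y, A y -> F y <= M.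
Proof.
move=> fA; exists (1 + \sum_(y \in A) `|F y|).
  by have : 0 <= \sum_(y \in A) `|F y|; [exact: fsumr_ge0|lra].
move=> y Ay; have := fsum_ge_term fA (fun y _ => normr_ge0 (F y)) Ay.
by have := ler_norm (F y); lra.
Qed.

End FiniteBounds.

Section WeightedToLevel.
Variables (R : realType) (V : choiceType) (G : graph V) (Gamma : set (aut G)).
Hypothesis connG : connected_graph G.
Hypothesis lfG : locally_finite G.
Hypothesis subG : subgroup Gamma.
Hypothesis transG : vertex_transitive Gamma.
Variable o : V.
Local Notation W := (weight R Gamma o).

(* Each vertex [x] gets the copy [g_x C] of the component [C] with
   [g_x x0 = x]; averaging over [x \in F] the boundary of [F] in [g_x C], with
   weight [1 / #|F `&` L x|] where [L x] is the part of the copy lying in the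
   level of [x], counts every boundary vertex of [F] at most [#|X|] times. *)
Lemma w_amenable_level_amenable : w_amenable R Gamma o -> level_amenable R Gamma.
Proof.
move=> /(w_amenableP R connG lfG subG o) wam X fX x0 Xx0.
set H := component _ _; pose C := comp_set (slice R Gamma X) x0.
have HC : vertices H = C := component_vertices connG lfG subG o Xx0.
have Cx0 : C x0 by exact: comp_set_refl.
have W0 x : 0 < W x by exact: weight_gt0.
have [] // := amenableP R (H := H); first by rewrite HC; exists x0.
(* Otherwise every finite subset of [C] has a boundary in [H] of proportion at least [e]. *)
move=> _ amenH; apply: amenH => e e0; apply: contrapT => noK.
have expH K : K `<=` C -> finite_set K -> K !=set0 ->
    e * (ncard K)%:R <= (ncard (vertex_boundary (edges H) K))%:R.
  move=> KC fK K0; rewrite leNgt; apply/negP => Ke.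
  by apply: noK; exists K; rewrite HC.
have /choice[g gP] : forall x, exists g, Gamma g /\ g x0 = x.
  by move=> x; have [g] := transG x0 x; exists g.
have Gg x : Gamma (g x) by case: (gP x).
have gx x : g x x0 = x by case: (gP x).
pose c x := W (g x o).
have Wc x z : W (g x z) = c x * W z by exact: weight_image.
have c0 x : 0 < c x by exact: W0.
pose C' x := g x @` C.
(* If two copies meet at a point whose preimages in [C] have equal weight, the transition element
   [k] preserves weights and maps [C] to itself. The copies then coincide, and so do the weights of
   their base points. *)
have same x x' z z' : C z -> C z' -> g x z = g x' z' -> W z = W z' ->
    C' x = C' x' /\ W x = W x'.
  move=> Cz Cz' gzz' Wzz'; pose k := ((g x')^-1 * g x)%g.
  have Gk : Gamma k := subM subG (subV subG (Gg x')) (Gg x).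
  have kz : k z = z' by rewrite /k /= gzz'; exact: aut_funK.
  have k1 : W (k o) = 1.
    apply: (mulIf (lt0r_neq0 (W0 z))).
    by rewrite -(weight_image R connG lfG subG o z Gk) kz mul1r.
  have kC : k @` C = C.
    by apply: (component_image connG lfG subG Gk k1 Cz); rewrite kz.
  split.
    rewrite /C' -[in RHS]kC image_comp; apply: eq_imagel => y _ /=.
    by rewrite aut_invK.
  rewrite -(gx x) -(gx x') !Wc; congr (_ * _).
  by apply: (mulIf (lt0r_neq0 (W0 z))); rewrite -Wc gzz' Wc Wzz'.
have [m m0 mX] := finite_pos_lower_bound fX (fun x _ => W0 x).
have mC y : C y -> m <= W y.
  by move=> /(comp_slice_vertices connG lfG subG o Xx0)[x Xx ->]; exact: mX.
have X0 : (0 < (ncard X)%:R :> R).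
  rewrite ltr0n; apply: ncard_gt0 => //.
  by have [x Xx _] := comp_slice_vertices connG lfG subG o Xx0 Cx0; exists x.
pose n : R := (ncard X)%:R.
(* A copy based at [x] contributes at least [e * m * c x], where [c x] is [W x / W x0], and boundary
   vertices are counted at most [n] times. *)
have eps0 : 0 < e * m / W x0 / n by rewrite divr_gt0// divr_gt0// mulr_gt0.
have [F [fF F0 Fe]] := wam _ eps0.
have fdF := boundary_finite lfG fF.
set dF := vertex_boundary (adj G) F in Fe fdF.
pose L x := C' x `&` [set y | W y = W x].
pose u x : R := (ncard (F `&` L x))%:R^-1.
have FL0 x : F x -> 0 < (ncard (F `&` L x))%:R :> R.
  move=> Fx; rewrite ltr0n ncard_gt0//; first exact: finite_setIl.
  by exists x; split=> //; split=> //; exists x0.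
have u0 x : 0 <= u x by rewrite invr_ge0.
have lower x : F x -> e * m * c x <= u x * \sum_(y \in dF `&` [set y | C' x y]) W y.
  (* [K] is the part of [F] in the copy, pulled back to [C]. Its boundary in [H] is carried into
     [dF], and each carried vertex weighs at least [m * c x]. *)
  move=> Fx; pose K := C `&` [set z | F (g x z)].
  have fK : finite_set K.
    apply: (@sub_finite_set _ _ (aut_inv (g x) @` F)); last exact: finite_image.
    by move=> z [_ Fz]; exists (g x z) => //; exact: aut_funK.
  have fB : finite_set (vertex_boundary (edges H) K).
    apply: sub_finite_set (boundary_finite lfG fK) => y [nKy [z Kz /edges_adj zy]].
    by split=> //; exists z.
  have KC : K `<=` C by move=> z [].
  have Ke : e * (ncard K)%:R <= (ncard (vertex_boundary (edges H) K))%:R.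
    by apply: expH => //; exists x0; split=> //=; rewrite gx.
  have mc0 : 0 < m * c x by exact: mulr_gt0.
  rewrite [leRHS]mulrC ler_pdivlMr ?FL0//.
  apply: (@le_trans _ _ (\sum_(y \in g x @` vertex_boundary (edges H) K) W y)).
    rewrite fsbig_image; last by move=> y z _ _ /(can_inj (aut_funK (g x))).
    apply: (@le_trans _ _ (\sum_(y \in vertex_boundary (edges H) K) (m * c x))).
      rewrite fsum_const; apply: le_trans (ler_wpM2r (ltW mc0) Ke).
      set N := _%:R; have -> : e * m * c x * N = e * N * (m * c x) by ring.
      apply: ler_wpM2r; first exact: ltW.
      apply: ler_wpM2l; first exact: ltW.
      rewrite ler_nat -(ncard_image K (can_inj (aut_funK (g x)))).
      apply: ncard_le; first exact: finite_image.
      by move=> y [Fy [[z Cz zy] _]]; exists z => //; split=> //; rewrite /= zy.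
    apply: ler_fsum => // y [_ [z _ [_ _ Cy]]].
    by rewrite Wc mulrC; apply: ler_wpM2l; [exact: ltW|exact: mC].
  apply: ler_fsum_sub => [||y _]; [exact: finite_setIl| |exact/ltW].
  move=> _ [y [nKy [z [Cz Fz] [/edges_adj zy _ Cy]]] <-].
  split; last by exists y.
  split; first by move=> Fy; exact: nKy.
  by exists (g x z) => //; apply/aut_adj.
have upper y : \sum_(x \in F `&` [set x | C' x y]) u x <= n.
  (* The copies containing [y] are sorted by the weight in [C] of the preimage of [y], which is the
     weight of some [v] in [X]. *)
  pose T x v := C' x y /\ W (aut_inv (g x) y) = W v.
  apply: (@le_trans _ _ (\sum_(x \in F `&` [set x | C' x y])
      \sum_(v \in X `&` [set v | T x v]) u x)).
    apply: ler_fsum; first exact: finite_setIl.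
    move=> x [Fx C'xy]; rewrite fsum_const -[leLHS]mul1r ler_wpM2r//.
    rewrite ler1n ncard_gt0//; first exact: finite_setIl.
    have [z Cz zy] := C'xy.
    have [v Xv zv] := comp_slice_vertices connG lfG subG o Xx0 Cz.
    by exists v; split=> //; split=> //; rewrite -zy aut_funK.
  rewrite (exchange_fsum_dep T)//; last exact: finite_setIl.
  rewrite /n ncard_sum; apply: ler_fsum => // v Xv.
  have [->|/set0P[x1 [[Fx1 _] [[z1 Cz1 z1y] Wz1]]]] :=
      eqVneq ((F `&` [set x | C' x y]) `&` [set x | T x v]) set0.
    by rewrite fsbig_set0.
  rewrite -z1y aut_funK in Wz1.
  (* Within the class of [v] all base points lie in the one set [L x1], each with weight [1 / #|F]
     meet [L x1|], so a class contributes at most 1. *)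
  have LE x : T x v -> L x = L x1 /\ L x1 x.
    move=> [[z Cz zy]]; rewrite -zy aut_funK => Wz.
    have [E1 E2] : C' x = C' x1 /\ W x = W x1.
      by apply: (same x x1 z z1) => //; rewrite ?zy ?z1y// Wz.
    split; first by rewrite /L E1 E2.
    by split=> //; rewrite -E1; exists x0.
  apply: (@le_trans _ _ (\sum_(x \in F `&` L x1) u x1)); last first.
    by rewrite fsum_const divff// lt0r_neq0// FL0.
  apply: (@le_trans _ _ (\sum_(x \in (F `&` [set x | C' x y]) `&` [set x | T x v]) u x1)).
    apply: ler_fsum; first by do 2!apply: finite_setIl.
    by move=> x [_ /LE[E _]]; rewrite /u E.
  apply: ler_fsum_sub => //; first exact: finite_setIl.
  by move=> x [[Fx _] /LE[_]].
suff : e * m / W x0 / n * \sum_(x \in F) W x <= \sum_(y \in dF) W y by rewrite leNgt Fe.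
rewrite mulrAC ler_pdivrMr// mulr_fsuml.
apply: (@le_trans _ _ (\sum_(x \in F) u x * \sum_(y \in dF `&` [set y | C' x y]) W y)).
  rewrite mulr_fsumr; apply: ler_fsum => // x Fx.
  apply: le_trans (lower x Fx).
  by rewrite -[in leLHS](gx x) Wc mulrCA mulrC divfK// lt0r_neq0.
under eq_fsbigr do rewrite mulr_fsumr.
rewrite (exchange_fsum_dep (fun x y => C' x y))//.
apply: ler_fsum => // y dFy; rewrite -mulr_fsuml mulrC ler_wpM2l ?upper//.
exact: ltW.
Qed.

End WeightedToLevel.

(** * Level-amenability implies weighted amenability *)

Section Growth.

Lemma ncard_image_finType (T : finType) (I : choiceType) (f : T -> I) (A : set I) :
  (forall a, A a -> exists x, f x = a) -> (ncard A <= #|T|)%N.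
Proof.
move=> fA; have sub : A `<=` f @` [set: T] by move=> a /fA[x <-]; exists x.
have fin : finite_set (f @` [set: T]) by exact/finite_image/finite_finset.
apply: leq_trans (ncard_le fin sub) _.
have -> : f @` [set: T] = [set` [fset f x | x in T]%fset].
  apply/seteqP; split=> [_ [x _ <-]|_ /imfsetP[x _ ->]]; last by exists x.
  by apply/imfsetP; exists x.
rewrite /ncard set_fsetK cardE; apply: leq_trans (leq_imfset_card _ _ _) _.
by apply: uniq_leq_size => [|x _]; [exact: enum_finmem_uniq|rewrite mem_enum].
Qed.

(** Otherwise [b n] would be at least [(1 + e) ^+ n], which outgrows every polynomial. *)
Lemma polynomial_growth (R : archiRealFieldType) (b : nat -> nat) d (e : R) : 0 < e ->
  (0 < b 0)%N -> (forall n, b n <= n.+1 ^ d)%N ->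
  exists n, (b n.+1)%:R <= (1 + e) * (b n)%:R.
Proof.
move=> e0 b0 bd; apply: contrapT => /forallNP nb.
have e1 : 0 < 1 + e by lra.
have exp_le n : (1 + e) ^+ n <= (b n)%:R.
  elim: n => [|n IH]; first by rewrite expr0 ler1n.
  rewrite exprS; apply: le_trans (ler_wpM2l (ltW e1) IH) _.
  by have /negP := nb n; rewrite -ltNge => /ltW.
have bern n : n%:R * e <= (1 + e) ^+ n.
  elim: n => [|n IH]; first by rewrite mul0r expr0.
  have p1 : 1 <= (1 + e) ^+ n by apply: exprn_ege1; lra.
  rewrite exprS -natr1 mulrDl mul1r; nra.
(* Bernoulli's inequality at [n], raised to the power [d.+1], is compared with the polynomial bound
   at [n * d.+1]. The exponent of [n] is then one larger on the left, and [n] is taken beyond the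
   quotient of the constants. *)
pose n := (Num.bound (d.+2%:R ^+ d / e ^+ d.+1)).+1.
have nlt : d.+2%:R ^+ d < n%:R * e ^+ d.+1.
  rewrite -ltr_pdivrMr ?exprn_gt0//; apply: lt_le_trans (archi_boundP _) _.
    by rewrite divr_ge0 ?exprn_ge0// ltW.
  by rewrite ler_nat.
have n0 : 0 < n%:R :> R by rewrite ltr0n.
have : (n%:R * e) ^+ d.+1 <= (n%:R * d.+2%:R) ^+ d.
  apply: (@le_trans _ _ ((1 + e) ^+ (n * d.+1))).
    by rewrite exprM lerXn2r// ?nnegrE ?exprn_ge0 ?mulr_ge0// ltW.
  apply: le_trans (exp_le _) _; rewrite -natrM -natrX ler_nat.
  apply: leq_trans (bd _) _; have [->//|d0] := posnP d.
  by rewrite leq_exp2r// /n; lia.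
rewrite !exprMn exprS -mulrA mulrCA ler_pM2l ?exprn_gt0//.
by rewrite leNgt nlt.
Qed.

End Growth.

Section LevelToWeighted.
Variables (R : realType) (V : choiceType) (G : graph V) (Gamma : set (aut G)).
Hypothesis connG : connected_graph G.
Hypothesis lfG : locally_finite G.
Hypothesis subG : subgroup Gamma.
Hypothesis transG : vertex_transitive Gamma.
Variable o : V.
Local Notation W := (weight R Gamma o).
Local Notation va := (vertex_action G).

Lemma neighbors1_finite x : finite_set (neighbors G [set x]).
Proof. by apply: neighbors_finite => //; exact: finite_set1. Qed.

Lemma neighbors1_image (g : aut G) x :
  neighbors G [set g x] = g @` neighbors G [set x].
Proof. by rewrite -neighbors_image image_set1. Qed.

(** By transitivity, the neighbors of [x] weigh [W x] times as much as the neighbors of [o]; a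
    vertex with several neighbors in [A] is only overcounted. *)
Lemma sum_neighbors_le (A : set V) : finite_set A ->
  \sum_(y \in neighbors G A) W y <=
  (\sum_(z \in neighbors G [set o]) W z) * \sum_(x \in A) W x.
Proof.
move=> fA; have W0 x : 0 <= W x by exact/ltW/weight_gt0.
have fN := neighbors_finite lfG fA.
apply: (@le_trans _ _ (\sum_(y \in neighbors G A)
    \sum_(x \in A `&` [set x | adj G x y]) W y)).
  apply: ler_fsum => // y [x Ax xy]; rewrite fsum_const -[leLHS]mul1r ler_wpM2r//.
  by rewrite ler1n ncard_gt0//; [exact: finite_setIl|exists x].
rewrite (exchange_fsum_dep (fun y x => adj G x y))// mulr_fsumr.
apply: ler_fsum => // x Ax; have [g Gg gx] := transG o x.
apply: (@le_trans _ _ (\sum_(y \in g @` neighbors G [set o]) W y)).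
  rewrite -(neighbors1_image g o) gx.
  by apply: ler_fsum_sub => //; [exact: neighbors1_finite|move=> y [_ ?]; exists x].
rewrite fsbig_image; last by move=> y z _ _ /(can_inj (aut_funK g)).
rewrite mulr_fsuml; apply: ler_fsum; first exact: neighbors1_finite.
move=> z _; rewrite (weight_image R connG lfG subG o z Gg).
by rewrite -[in leRHS]gx mulrC.
Qed.

Lemma weight_step x y : adj G x y ->
  exists2 z, neighbors G [set o] z & W y = W x * W z.
Proof.
move=> xy; have [g Gg gx] := transG x o.
exists (g y); first by exists o => //; rewrite -gx; apply/aut_adj.
rewrite -gx (weight_act R subG _ _ Gg) gx.
by rewrite (weight_cocycle R connG lfG subG y x o) mulrC.
Qed.

(* [W y] is the product of the weights along a path from [o], hence it only
   depends on how often each neighbor weight occurs. *)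
Lemma weight_ball_growth n : (ncard (W @` ball G [set o] n) <=
  n.+1 ^ ncard (neighbors G [set o]))%N.
Proof.
pose s : seq V := fset_set (neighbors G [set o]); pose d := size s.
have prodP y : ball G [set o] n y -> exists f : {ffun 'I_d -> 'I_n.+1},
    \prod_(i < d) W (nth o s i) ^+ f i = W y.
  elim: n y => [y ->|n IH y].
    exists [ffun=> ord0]; rewrite (weightxx R connG lfG subG o).
    by apply: big1 => i _; rewrite ffunE expr0.
  move=> [/IH[f <-]|[x /IH[f fx] /weight_step[z Nz ->]]].
    exists [ffun i => widen_ord (leqnSn _) (f i)].
    by apply: eq_bigr => i _; rewrite ffunE.
  have sz : z \in s by rewrite /s in_fset_set ?inE//; exact: neighbors1_finite.
  have zd : (index z s < d)%N by rewrite index_mem.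
  pose i0 := Ordinal zd.
  (* The exponent of the neighbor weight just used goes up by one, [lift ord0] being the
     successor. *)
  exists [ffun i => if i == i0 then lift ord0 (f i) else widen_ord (leqnSn _) (f i)].
  rewrite -fx (bigD1 i0)//= [in RHS](bigD1 i0)//= ffunE eqxx lift0 exprS.
  rewrite nth_index// [RHS]mulrC mulrA; congr (_ * _).
  by apply: eq_bigr => i /negPf ii0; rewrite ffunE ii0.
have -> : ncard (neighbors G [set o]) = d by [].
have := ncard_image_finType (T := {ffun 'I_d -> 'I_n.+1})
  (f := fun f => \prod_(i < d) W (nth o s i) ^+ f i) (A := W @` ball G [set o] n).
rewrite card_ffun !card_ord; apply.
by move=> _ [y /prodP[f <-] <-]; exists f.
Qed.

(* In the orbit of the edge [(x, y)], out-degrees and in-degrees have ratio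
   [W y / W x]. *)
Lemma level_edges_le (K Y : set V) (l : R) y0 :
  finite_set K -> finite_set Y -> neighbors G [set o] y0 ->
  (forall x, K x -> W x = l) ->
  (forall x y, K x -> adj G x y -> W y = l * W y0 -> Y y) ->
  (ncard K)%:R <= (ncard Y)%:R * W y0.
Proof.
move=> fK fY Ny0 Kl KY.
pose E x y := exists h, [/\ Gamma h, h o = x & h y0 = y].
pose dp := ncard (orbit va (stab va Gamma o) y0).
pose dm := ncard (orbit va (stab va Gamma y0) o).
have ad : adj G o y0 by case: Ny0 => _ ->.
have dp0 : (0 < dp)%N.
  apply: ncard_orbit_gt0; first exact: stab_subgroup.
  exact: stab_orbit_finite.
(* [W y0] is [dm / dp] by definition. Each vertex of [K] has [dp] edges of the orbit into [Y], and
   each vertex of [Y] receives at most [dm]. *)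
suff : (ncard K * dp <= ncard Y * dm)%N.
  rewrite -(ler_nat R) !natrM -ler_pdivlMr ?ltr0n// => /le_trans; apply.
  by rewrite -mulrA.
apply: (double_count_le (P := E) fK fY) => [x Kx|y Yy].
  have [g Gg gx] := transG o x.
  rewrite /dp -(ncard_image _ (can_inj (aut_funK g))).
  have := orbit_fiber va va subG o y0 Gg => /= <-.
  apply: ncard_le; first exact: finite_setIl.
  move=> y [h [Gh ho hy]]; split; last by exists h; rewrite ho gx.
  apply: (KY x) => //; first by rewrite -gx -ho -hy; apply/aut_adj.
  by rewrite -hy (weight_image R connG lfG subG o y0 Gh) ho gx (Kl x Kx).
have [g Gg gy] := transG y0 y.
rewrite /dm -[leqRHS](ncard_image _ (can_inj (aut_funK g))).
have := orbit_fiber va va subG y0 o Gg => /= <-.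
apply: ncard_le.
  have -> : [set b' : V | exists h, [/\ Gamma h, h y0 = g y0 & h o = b']] =
      g @` orbit va (stab va Gamma y0) o by rewrite -orbit_fiber.
  by apply: finite_image; exact: stab_orbit_finite.
by move=> x [_ [h [Gh ho hy]]]; exists h; rewrite hy gy.
Qed.

Lemma level_amenable_w_amenable : level_amenable R Gamma -> w_amenable R Gamma o.
Proof.
move=> lev; apply/(w_amenableP R connG lfG subG o) => e e0.
have W0 x : 0 < W x by exact: weight_gt0.
pose N := neighbors G [set o].
pose M := \sum_(z \in N) W z.
have M0 : 0 <= M by exact: sum_weight_ge0.
(* Two errors have to fit below [e]: the boundary seen from the outer levels, at most [M * eps] in
   proportion, and all terms coming from the boundary inside the slice, at most [eps]. *)
pose eps := e / (2 * (M + 1)).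
have eps0 : 0 < eps by rewrite divr_gt0//; lra.
have epsM : M * eps + eps < e.
  have -> : M * eps + eps = e / 2 by rewrite /eps; field; lra.
  lra.
have fball n : finite_set (ball G [set o] n).
  by apply: ball_finite => //; exact: finite_set1.
have fWball n : finite_set (W @` ball G [set o] n) by exact: finite_image.
have oball n : ball G [set o] n o.
  exact: (subset_ball (leq0n n) (erefl : ball G [set o] 0 o)).
have b0 : (0 < ncard (W @` ball G [set o] 0))%N.
  by apply: ncard_gt0 => //; exists (W o); exists o.
have [n grow] := polynomial_growth eps0 b0 weight_ball_growth.
(* The slice uses radius [n.+1], so that an edge leaving it must start at a level in [O], one that
   is not met within radius [n]. By the choice of [n] there are few such levels. *)
pose X := ball G [set o] n.+1; pose B := W @` X.
pose B' := W @` ball G [set o] n; pose O := B `\` B'.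
have fO : finite_set O by exact: finite_setD (fWball n.+1).
have fB' : finite_set B' := fWball n.
have B'B : B' `<=` B by move=> _ [x bx <-]; exists x => //; left.
have cardO : (ncard O)%:R <= eps * (ncard B')%:R.
  suff : (ncard B)%:R = (ncard B')%:R + (ncard O)%:R :> R.
    by move: grow; rewrite -/B -/B' => + E; rewrite E; lra.
  rewrite !ncard_sum (fsbigID B' B)//=; last exact: fWball.
  by rewrite (setIidr B'B).
have Xo : vertices (slice R Gamma X) o.
  by rewrite (slice_vertices R connG lfG subG o); exists o => //; exact: oball.
pose C := comp_set (slice R Gamma X) o.
have HC := component_vertices connG lfG subG o Xo.
have := lev X (fball _) o Xo; set H := component _ _ in HC *.
move=> amH.
have amenH : forall e : R, 0 < e -> exists K : set V,
    [/\ K `<=` C, finite_set K, K !=set0 &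
      (ncard (vertex_boundary (edges H) K))%:R < e * (ncard K)%:R].
  by rewrite /C -HC; apply/amenableP => //; exists o; rewrite HC; exact: comp_set_refl.
have CB x : C x -> B (W x).
  by move=> /(comp_slice_vertices connG lfG subG o Xo)[y Xy ->]; exists y.
have CH x y : C x -> adj G x y -> B (W y) -> edges H x y.
  move=> Cx xy [z Xz zy].
  have := component_edges connG lfG subG Xo Cx xy (ex_intro2 _ _ z Xz (esym zy)).
  by [].
have [L L0 BL] := finite_upper_bound id (fWball n.+1).
have [m m0 Bm] := finite_pos_lower_bound (F := id) (fWball n.+1)
  (fun l Bl => let: ex_intro2 x _ xl := Bl in eq_ind _ (fun l => 0 < l) (W0 x) _ xl).
(* The total coefficient, in the final estimate, of the number [D] of boundary vertices of [K] in
   the slice. *)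
pose E' := L * (1 + M * ((ncard O)%:R * (2 * n.+1%:R))).
have E'0 : 0 < E'.
  by apply: mulr_gt0 => //; rewrite ltr_wpDr// !mulr_ge0.
have [|K [KC fK K0 Keta]] := amenH (eps * m / E').
  by rewrite divr_gt0// mulr_gt0.
set dK := vertex_boundary (edges H) K in Keta.
have dKC y : dK y -> C y.
  by move=> [_ [x _ []]].
have fdK : finite_set dK.
  apply: sub_finite_set (boundary_finite lfG fK) => y [nKy [z Kz /edges_adj zy]].
  by split=> //; exists z.
pose D : R := (ncard dK)%:R.
pose k (l : R) := \sum_(x \in K `&` [set x | W x = l]) W x.
have k0 l : 0 <= k l by exact: sum_weight_ge0.
have wK0 := sum_weight_gt0 R connG lfG subG o fK K0.
have kE l : k l = (ncard (K `&` [set x | W x = l]))%:R * l.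
  by rewrite -fsum_const; apply: eq_fsbigr => x /set_mem[].
(* The orbit of the edge leads from the part of [K] in the level of [x] into the level of [y], where
   it ends in [K] or in [dK]. The [D] vertices of [dK] weigh at most [L] each. *)
have kstep x y : adj G x y -> B (W x) -> B (W y) -> k (W x) <= k (W y) + L * D.
  move=> xy Bx By; have [z Nz yE] := weight_step xy.
  pose Y := (K `|` dK) `&` [set y' | W y' = W y].
  have fY : finite_set Y by apply: finite_setIl; rewrite finite_setU.
  have le1 : (ncard (K `&` [set x' | W x' = W x]))%:R <= (ncard Y)%:R * W z.
    apply: (level_edges_le (l := W x)) => //; first exact: finite_setIl.
      by move=> x' [].
    move=> x' y' [Kx' Wx'] x'y' Wy'; have Wy'y : W y' = W y by rewrite Wy' yE.
    split=> //; have [Ky'|nKy'] := pselect (K y'); first by left.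
    right; split=> //; exists x' => //; apply: CH => //; first exact: KC.
    by rewrite Wy'y.
  have le2 : (ncard Y)%:R <= (ncard (K `&` [set x' | W x' = W y]))%:R + D.
    rewrite -natrD ler_nat.
    apply: (@leq_trans (ncard ((K `&` [set x' | W x' = W y]) `|` dK))).
      apply: ncard_le; first by rewrite finite_setU; split=> //; exact: finite_setIl.
      by move=> t [[Kt|dt] Wt]; [left|right].
    have fKy : finite_set (K `&` [set x' | W x' = W y]) by exact: finite_setIl.
    rewrite /ncard fset_setU//.
    by apply: leq_trans (leq_card_fsetU _ _) _.
  have LWy : W y <= L by exact: BL.
  have D0 : 0 <= D by [].
  rewrite !kE; apply: (@le_trans _ _ ((ncard Y)%:R * W y)).
    have -> : (ncard Y)%:R * W y = (ncard Y)%:R * W z * W x by rewrite yE; ring.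
    by apply: ler_wpM2r => //; exact: ltW.
  apply: (@le_trans _ _ (((ncard (K `&` [set x' | W x' = W y]))%:R + D) * W y)).
    by rewrite ler_wpM2r// ltW.
  by rewrite mulrDl lerD2l mulrC ler_wpM2r.
have D0 : 0 <= D by [].
have kball j y : (j <= n.+1)%N -> ball G [set o] j y ->
    k (W y) <= k (W o) + j%:R * (L * D) /\ k (W o) <= k (W y) + j%:R * (L * D).
  have LD0 : 0 <= L * D by rewrite mulr_ge0// ltW.
  elim: j y => [y _ ->|j IH y jn]; first by rewrite mul0r addr0.
  have jn' := ltnW jn; rewrite -natr1 mulrDl mul1r.
  move=> [/(IH _ jn')[]|[x bx xy]]; first by split; lra.
  have [] := IH _ jn' bx.
  have Bx : B (W x) by exists x => //; exact: (subset_ball jn').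
  have By : B (W y) by exists y => //; apply: (subset_ball jn); right; exists x.
  have := kstep _ _ xy Bx By; have := kstep _ _ (adj_sym xy) By Bx.
  by split; lra.
(* Both levels are compared with that of [o], which is at most [n.+1] steps away. *)
have kB l l' : B l -> B l' -> k l <= k l' + 2 * n.+1%:R * (L * D).
  move=> [x Xx <-] [y Xy <-].
  have [] := kball _ _ (leqnn _) Xx; have [] := kball _ _ (leqnn _) Xy.
  lra.
pose KO := K `&` [set x | O (W x)].
have wKO : \sum_(x \in KO) W x <= \sum_(l \in O) k l.
  rewrite /k (exchange_fsum_dep (fun l x => W x = l))//.
  rewrite fsbig_mkcondr; apply: ler_fsum => // x Kx.
  rewrite fsum_const; case: ifPn => [|_]; last by rewrite mulr_ge0// ltW.
  rewrite inE => Ox; rewrite -[leLHS]mul1r; apply: ler_wpM2r; first exact: ltW.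
  rewrite ler1n ncard_gt0//; first exact: finite_setIl.
  by exists (W x).
have wKB' : \sum_(l \in B') k l <= \sum_(x \in K) W x.
  rewrite /k (exchange_fsum_dep (fun l x => W x = l))//.
  apply: ler_fsum => // x Kx; rewrite fsum_const -[leRHS]mul1r.
  apply: ler_wpM2r; first exact: ltW.
  apply: (@le_trans _ _ (ncard [set W x])%:R); last by rewrite /ncard fset_set1 cardfs1.
  by rewrite ler_nat; apply: ncard_le; [exact: finite_set1|move=> l [_ /= ->]].
have nB'0 : 0 < (ncard B')%:R :> R.
  by rewrite ltr0n; apply: ncard_gt0; [exact: fWball|exists (W o); exists o].
have kO : \sum_(l \in O) k l <=
    eps * \sum_(x \in K) W x + (ncard O)%:R * (2 * n.+1%:R * (L * D)).
  (* Every outer level is compared with every inner one. Dividing by the number of inner levels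
     leaves the factor [eps] of [cardO] on the weight of [K]. *)
  have : (ncard B')%:R * \sum_(l \in O) k l <=
      (ncard O)%:R * (\sum_(x \in K) W x + (ncard B')%:R * (2 * n.+1%:R * (L * D))).
    rewrite -fsum_const.
    apply: (@le_trans _ _ (\sum_(l' \in B') \sum_(l \in O)
        (k l' + 2 * n.+1%:R * (L * D)))).
      apply: ler_fsum => // l' B'l'; apply: ler_fsum => // l [Bl _].
      by apply: kB => //; exact: B'B.
    rewrite exchange_fsbig// fsum_const ler_wpM2l//.
    by rewrite fsbig_split//= fsum_const lerD2r.
  move=> h; rewrite -(ler_pM2l nB'0); apply: le_trans h _.
  rewrite mulrDr [leRHS]mulrDr; apply: lerD.
    by rewrite mulrA [(_ * eps)]mulrC ler_wpM2r// ltW.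
  by rewrite mulrCA.
have bndK : vertex_boundary (adj G) K `<=` dK `|` neighbors G KO.
  move=> y [nKy [x Kx xy]]; have Cx := KC _ Kx.
  have [By|nBy] := pselect (B (W y)).
    by left; split=> //; exists x => //; exact: CH.
  right; exists x => //; split=> //; split; first exact: CB.
  (* If the weight of [x] occurred within radius [n], say at [x'], an element taking [x] to [x']
     would preserve weights and move [y] into radius [n.+1], so that [W y] would belong to [B]. *)
  move=> [x' bx' xx']; apply: nBy; have [g Gg gx] := transG x x'.
  exists (g y).
    by right; exists x' => //; rewrite -gx; apply/aut_adj.
  have g1 : W (g o) = 1.
    apply: (mulIf (lt0r_neq0 (W0 x))).
    by rewrite -(weight_image R connG lfG subG o x Gg) gx xx' mul1r.
  by rewrite (weight_image R connG lfG subG o y Gg) g1 mul1r.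
have fKO : finite_set KO by exact: finite_setIl.
have fNKO := neighbors_finite lfG fKO.
exists K; split=> //.
have wd : \sum_(y \in dK) W y <= L * D.
  rewrite mulrC -fsum_const; apply: ler_fsum => // y /dKC /CB.
  exact: BL.
have le1 : \sum_(y \in vertex_boundary (adj G) K) W y <=
    L * D + M * \sum_(x \in KO) W x.
  apply: (@le_trans _ _ (\sum_(y \in dK `|` (neighbors G KO `\` dK)) W y)).
    apply: ler_fsum_sub.
    - by rewrite finite_setU; split=> //; exact: finite_setD.
    - move=> y /bndK[dy|Ny]; first by left.
      by have [dy|ndy] := pselect (dK y); [left|right].
    - by move=> y _; exact: ltW.
  rewrite fsbigU0//; last 2 first.
  - exact: finite_setD.
  - by move=> y [dy [_]].
  apply: lerD => //; apply: le_trans (sum_neighbors_le fKO).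
  by apply: ler_fsum_sub => [//|y []//|y _]; exact: ltW.
have mK : m * (ncard K)%:R <= \sum_(x \in K) W x.
  by rewrite mulrC -fsum_const; apply: ler_fsum => // x /KC /CB; exact: Bm.
have DE : E' * D <= eps * \sum_(x \in K) W x.
  apply: (@le_trans _ _ (eps * (m * (ncard K)%:R))); last by rewrite ler_pM2l.
  move: (ltW Keta); rewrite -/D => h; rewrite -ler_pdivlMl//.
  by apply: le_trans h _; rewrite [E'^-1 * _]mulrC mulrA mulrAC.
have le2 : M * \sum_(x \in KO) W x <=
    M * (eps * \sum_(x \in K) W x + (ncard O)%:R * (2 * n.+1%:R * (L * D))).
  by apply: ler_wpM2l => //; exact: le_trans wKO kO.
apply: (@le_lt_trans _ _ ((M * eps + eps) * \sum_(x \in K) W x)); last first.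
  by rewrite ltr_pM2r.
apply: le_trans le1 _; apply: le_trans (lerD (lexx _) le2) _.
set S := \sum_(x \in K) W x in DE *; rewrite [leRHS]mulrDl.
apply: le_trans (lerD (lexx (M * eps * S)) DE).
rewrite [leLHS](_ : _ = M * eps * S + E' * D)//.
by rewrite /E'; ring.
Qed.

End LevelToWeighted.

(** * Hyperfiniteness implies weighted amenability *)

Section CountableMeasurability.
Context d (T : measurableType d).

Lemma countable_bigcup_measurable (U : Type) (D : set U) (F : U -> set T) :
  countable [set: U] -> (forall i, D i -> measurable (F i)) ->
  measurable (\bigcup_(i in D) F i).
Proof.
move=> cU mF; rewrite bigcup_mkcond; apply: countable_bigcupT_measurable => // i.
by case: ifP => [|_//]; rewrite inE; exact: mF.
Qed.

Lemma countable_bigcap_measurable (U : Type) (D : set U) (F : U -> set T) :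
  countable [set: U] -> (forall i, D i -> measurable (F i)) ->
  measurable (\bigcap_(i in D) F i).
Proof.
move=> cU mF; rewrite -[X in measurable X]setCK setC_bigcap.
apply: measurableC; apply: countable_bigcup_measurable => // i Di.
by apply: measurableC; exact: mF.
Qed.

Lemma countable_bigcup_null (R : realType) (mu : {measure set T -> \bar R})
    (U : Type) (F : U -> set T) : countable [set: U] ->
  (forall i, measurable (F i)) -> (forall i, mu (F i) = 0%E) ->
  mu (\bigcup_i F i) = 0%E.
Proof.
move=> cU mF F0; have /countable_injP[c cI] := cU.
apply/negligibleP; first exact: countable_bigcup_measurable.
have -> : \bigcup_i F i = \bigcup_n \bigcup_(i in [set i | c i = n]) F i.
  apply/seteqP; split=> t; first by move=> [i _ Fi]; exists (c i) => //; exists i.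
  by move=> [n _ [i _ Fi]]; exists i.
apply: negligible_bigcup => n; have [[i /= ci]|no] := pselect (exists i, c i = n).
  apply: negligibleS (proj2 (negligibleP mu (mF i)) (F0 i)) => t [j /= cj Fj].
  by rewrite (_ : i = j)//; apply: cI; rewrite ?inE// ci cj.
by apply: negligibleS (negligible_set0 mu) => t [i /= ci _]; apply: no; exists i.
Qed.

Lemma increasing_probability_near1 (R : realType) (P : probability T R)
    (F : (set T)^nat) (e : R) : (forall n, measurable (F n)) ->
  (forall n, F n `<=` F n.+1) -> P (\bigcup_n F n) = 1%E -> 0 < e ->
  exists n, ((1 - e)%:E < P (F n))%E.
Proof.
move=> mF ndF PF e0; apply: contrapT => /forallNP small.
have nd : nondecreasing_seq F.
  by apply/nondecreasing_seqP => n; apply/subsetPset.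
have cv := nondecreasing_cvg_mu mF (bigcupT_measurable F mF) nd (mu := P).
have : (P (\bigcup_n F n) <= (1 - e)%:E)%E.
  rewrite -(cvg_lim _ cv)//; apply: lime_le; first by apply/cvg_ex; eexists; exact: cv.
  by apply: nearW => n; have /negP := small n; rewrite -leNgt.
by rewrite PF lee_fin; lra.
Qed.

End CountableMeasurability.

(** * Measurability of cluster events *)

Section Configurations.
Variables (V : choiceType) (G : graph V).
Hypothesis countV : countable [set: V].

Lemma edges_measurable x y : measurable [set H : configuration G | edges H x y].
Proof. by apply: sub_sigma_algebra; right; exists (x, y). Qed.

(** Being connected is a countable union over the length of a walk and its vertices; [reach n y] is
    the event of a walk with [n] steps from [x] to [y]. *)
Lemma comp_set_measurable x y :
  measurable [set H : configuration G | comp_set H x y].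
Proof.
pose reach := fix reach n y : set (configuration G) := if n is m.+1
  then \bigcup_z (reach m z `&` [set H : configuration G | edges H z y])
  else [set H : configuration G | x = y].
have mreach n z : measurable (reach n z).
  elim: n z => [|n IH] z /=.
    have [xz|xz] := pselect (x = z).
      by rewrite (_ : mkset _ = setT)//; apply/seteqP; split.
    by rewrite (_ : mkset _ = set0)//; apply/seteqP; split=> H // /xz.
  apply: countable_bigcup_measurable => // u _.
  by apply: measurableI => //; exact: edges_measurable.
rewrite (_ : mkset _ = \bigcup_n reach n y); first exact: bigcupT_measurable.
apply/seteqP; split=> [H xy|H [n _]].
  elim: (clos_rt_rtn1 _ _ _ _ xy) => [|u v uv _ [n _ nu]]; first by exists 0%N.
  by exists n.+1 => //; exists u.
elim: n y => [y ->|n IH y [z _ [/IH xz zy]]]; first exact: comp_set_refl.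
exact: comp_set_step xz zy.
Qed.

Lemma comp_set_eq_measurable x K :
  measurable [set H : configuration G | comp_set H x = K].
Proof.
rewrite (_ : mkset _ = \bigcap_y [set H : configuration G | comp_set H x y = K y]).
  apply: countable_bigcap_measurable => // y _.
  have [Ky|nKy] := pselect (K y).
    rewrite (_ : mkset _ = [set H : configuration G | comp_set H x y]).
      exact: comp_set_measurable.
    by apply/seteqP; split=> H /=; [move=> ->|move=> ?; apply/propext].
  rewrite (_ : mkset _ = ~` [set H : configuration G | comp_set H x y]).
    by apply: measurableC; exact: comp_set_measurable.
  apply/seteqP; split=> H /=; first by move=> ->.
  by move=> ?; apply/propext.
apply/seteqP; split=> [H /= <- y _ //|H HK /=].
by apply/seteqP; split=> y; have /= -> := HK y I.
Qed.

End Configurations.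

Section HyperfiniteToWeighted.
Variables (R : realType) (V : choiceType) (G : graph V) (Gamma : set (aut G)).
Hypothesis connG : connected_graph G.
Hypothesis lfG : locally_finite G.
Hypothesis subG : subgroup Gamma.
Hypothesis transG : vertex_transitive Gamma.
Variable o : V.
Local Notation W := (weight R Gamma o).
Local Notation va := (vertex_action G).

(** Mass transport needs a part of [K] itself, whence the inner instead of the outer boundary. *)
Definition inner_boundary (K : set V) : set V :=
  [set x | K x /\ exists2 y, ~ K y & adj G x y].

Lemma inner_boundary_image (g : aut G) K :
  inner_boundary (g @` K) = g @` inner_boundary K.
Proof.
apply/seteqP; split=> [_ [[x Kx <-] [y nKy xy]]|_ [x [Kx [y nKy xy]] <-]].
  exists x => //; split=> //; exists (aut_inv g y).
    by move=> Ky; apply: nKy; exists (aut_inv g y) => //; exact: aut_invK.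
  by apply/(aut_adj g); rewrite aut_invK.
split; first by exists x.
exists (g y); last exact/aut_adj.
by move=> [z Kz /(can_inj (aut_funK g)) zy]; apply: nKy; rewrite -zy.
Qed.

Lemma boundary_le_inner_boundary K : finite_set K ->
  \sum_(y \in vertex_boundary (adj G) K) W y <=
  (\sum_(z \in neighbors G [set o]) W z) * \sum_(x \in inner_boundary K) W x.
Proof.
move=> fK; have fI : finite_set (inner_boundary K).
  by apply: sub_finite_set fK => x [].
apply: (@le_trans _ _ (\sum_(y \in neighbors G (inner_boundary K)) W y)); last first.
  exact: sum_neighbors_le.
apply: ler_fsum_sub; first exact: neighbors_finite.
  by move=> y [nKy [x Kx xy]]; exists x => //; split=> //; exists y.
by move=> x _; exact/ltW/weight_gt0.
Qed.

(** * The cluster of the reference vertex *)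

Section Clusters.
Context d (Omega : measurableType d) (P : probability Omega R).
Variable omega_ : nat -> {mfun Omega >-> configuration G}.
Hypothesis exhaustion :
  @hyperfinite_exhaustion V G Gamma R d Omega P (cst (full_subgraph G)) omega_.

Let countV : countable [set: V] := vertices_countable connG lfG o.

Let cluster n x K : set Omega := [set w | comp_set (omega_ n w) x = K].

Let cluster_measurable n x K : measurable (cluster n x K).
Proof.
exact: (measurable_funPTI (omega_ n) (comp_set_eq_measurable countV x K)).
Qed.

Let cluster_image n x K g : Gamma g ->
  P (cluster n (g x) (g @` K)) = P (cluster n x K).
Proof.
move=> Gg; have [_ _ inv _] := exhaustion.
have := inv g Gg [set c : joint_configuration G | comp_set (c.2 n) (g x) = g @` K].
rewrite /pushforward /= => <-; last first.
  rewrite (_ : mkset _ = snd @^-1` [set u : g_sigma_algebraType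
      (@seq_cylinders _ (configuration G)) | comp_set (u n) (g x) = g @` K])//.
  rewrite -[X in measurable X]setTI; apply: measurable_snd => //.
  apply: sub_sigma_algebra; exists n.
  exists [set H : configuration G | comp_set H (g x) = g @` K].
  by split=> //; exact: comp_set_eq_measurable.
congr (P _); apply/seteqP; split=> w /=; rewrite comp_set_act.
  exact: (act_inj (t := set_action va)).
by move=> ->.
Qed.

Let P_cluster n K : P (cluster n o K) = (fine (P (cluster n o K)))%:E.
Proof. by rewrite fineK// fin_num_measure. Qed.

(* Bounded candidates for the cluster of [o], as a [Gamma]-invariant
   condition. *)
Let bounded r : set (set V) :=
  [set K | K o /\ forall x, K x -> K `<=` ball G [set x] r].

Let bounded_sub r K : bounded r K -> K `<=` ball G [set o] r.
Proof. by move=> [Ko]; apply. Qed.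

Let bounded_finite r K : bounded r K -> finite_set K.
Proof.
move=> /bounded_sub /sub_finite_set; apply.
by apply: ball_finite => //; exact: finite_set1.
Qed.

Let bounded_set_finite r : finite_set (bounded r).
Proof.
apply: sub_finite_set (finite_subsets (ball_finite lfG r (finite_set1 o))).
by move=> K; exact: bounded_sub.
Qed.

Let cluster_trivIset n D : trivIset D (cluster n o).
Proof. by move=> K L _ _ [w [/= <- <-]]. Qed.

Let probability_clusters n r (Q : set (set V)) :
  P (\bigcup_(K in bounded r `&` Q) cluster n o K) =
  (\sum_(K \in bounded r `&` Q) fine (P (cluster n o K)))%:E.
Proof.
have fQ : finite_set (bounded r `&` Q) by exact: finite_setIl.
rewrite measure_fin_bigcup// -fsumEFin//.
by apply: eq_fsbigr => K _; exact: P_cluster.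
Qed.

(** Almost surely the cluster of [o] is finite, and then one radius serves all pairs of its
    vertices. *)
Let bounded_cover n : P (\bigcup_r \bigcup_(K in bounded r) cluster n o K) = 1%E.
Proof.
set U := \bigcup_r _; have mU : measurable U.
  apply: bigcupT_measurable => r; apply: fin_bigcup_measurable => [|K _].
    exact: bounded_set_finite.
  exact: cluster_measurable.
have : P (~` U) = 0%E.
  apply/negligibleP; first exact: measurableC.
  have [_ _ _ /(_ n)] := exhaustion; apply: negligibleS => w nU fin; apply: nU.
  set K := comp_set (omega_ n w) o.
  have fK : finite_set K.
    (* If [o] is not a vertex of [omega_ n w], no edge ends there and [comp_set] is the single point
       [o]. *)
    have [|no] := pselect (vertices (omega_ n w) o); first exact: fin.
    apply: (@sub_finite_set _ _ [set o]); last exact: finite_set1.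
    move=> y /comp_set_sym oy; elim: (clos_rt_rtn1 _ _ _ _ oy) no => // u v uv _ _ [].
    exact: edges_vertices (edges_sym uv).
  have [r rP] : exists r, forall p, (K `*` K) p -> ball G [set p.1] r p.2.
    apply: (finite_uniform_bound (Q := fun p r => ball G [set p.1] r p.2)).
    - exact: finite_setX.
    - by move=> p i j ij; exact: (subset_ball ij).
    by move=> p _; exact: ball_cover.
  exists r => //; exists K => //; split; first exact: comp_set_refl.
  by move=> x Kx y Ky; exact: (rP (x, y)).
by move=> U0; rewrite -[U]setCK probability_setC ?U0 ?sube0//; exact: measurableC.
Qed.

(** All edges at [o] are present; then [o] is not on the inner boundary of its cluster. *)
Let good n : set Omega :=
  [set w | forall y, neighbors G [set o] y -> edges (omega_ n w) o y].

Let good_measurable n : measurable (good n).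
Proof.
rewrite (_ : good n = \bigcap_(y in neighbors G [set o])
    (omega_ n @^-1` [set H : configuration G | edges H o y])).
  apply: countable_bigcap_measurable => // y _.
  by apply: measurable_funPTI; exact: edges_measurable.
by [].
Qed.

Let good_cover : P (\bigcup_n good n) = 1%E.
Proof.
have [mono cov _ _] := exhaustion.
rewrite (_ : \bigcup_n _ = setT); first exact: probability_setT.
apply/seteqP; split=> // w _.
have [n nP] : exists n, forall y, neighbors G [set o] y -> edges (omega_ n w) o y.
  apply: (finite_uniform_bound (Q := fun y n => edges (omega_ n w) o y)).
    exact: neighbors1_finite.
    move=> y i j /subnK <-; elim: (j - i)%N => // k IH /IH.
    by have [_] := mono (k + i)%N w; apply.
  by move=> y [_ -> oy]; have [_ /(_ o y)[_]] := cov w; apply.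
by exists n.
Qed.

Lemma hyperfinite_exhaustion_w_amenable : w_amenable R Gamma o.
Proof.
apply/(w_amenableP R connG lfG subG o) => e e0; apply: contrapT => noF.
pose M := \sum_(z \in neighbors G [set o]) W z.
have M0 : 0 <= M by exact: sum_weight_ge0.
(* A lower bound for the proportion of the inner boundary, since the outer one weighs at most [M]
   times as much; [M + 1] keeps the denominator positive. *)
pose c := e / (M + 1).
have c0 : 0 < c by rewrite divr_gt0//; lra.
have iso F : finite_set F -> F !=set0 ->
    c <= (\sum_(x \in inner_boundary F) W x) / (\sum_(x \in F) W x).
  move=> fF F0; have WF := sum_weight_gt0 R connG lfG subG o fF F0.
  rewrite ler_pdivlMr//.
  have : e * \sum_(x \in F) W x <= \sum_(y \in vertex_boundary (adj G) F) W y.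
    by rewrite leNgt; apply/negP => Fe; apply: noF; exists F.
  move=> /le_trans /(_ (boundary_le_inner_boundary fF)); rewrite -/M => le1.
  have I0 : 0 <= \sum_(x \in inner_boundary F) W x by exact: sum_weight_ge0.
  rewrite /c mulrAC ler_pdivrMr; last lra.
  by apply: le_trans le1 _; rewrite mulrC ler_wpM2l//; lra.
(* Chosen so that [c * (1 - delta) - delta = c / 2]. *)
pose delta := c / (2 * (1 + c)).
have delta0 : 0 < delta by rewrite divr_gt0//; lra.
have deltac : delta < c * (1 - delta).
  rewrite -subr_gt0 (_ : _ - _ = c / 2); first lra.
  by rewrite /delta; field; lra.
have mono n : good n `<=` good n.+1.
  by move=> w wn y /wn; have [/(_ n w)[_ + _ _ _]] := exhaustion; apply.
have [n Pgood] := increasing_probability_near1 good_measurable mono good_cover delta0.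
pose F r := \bigcup_(K in bounded r) cluster n o K.
have mF r : measurable (F r).
  apply: fin_bigcup_measurable => [|K _].
    exact: bounded_set_finite.
  exact: cluster_measurable.
have monoF r : F r `<=` F r.+1.
  move=> w [K [Ko Kr] wK]; exists K => //; split=> // x /Kr Kx y /Kx.
  by apply: subset_ball.
have [r Pbounded] := increasing_probability_near1 mF monoF (bounded_cover n) delta0.
pose q K := fine (P (cluster n o K)).
have q0 K : 0 <= q K by exact: fine_ge0.
have sum1 : 1 - delta < \sum_(K \in bounded r) q K.
  by have := probability_clusters n r setT; rewrite setIT -lte_fin -/q => <-.
have sum2 : \sum_(K \in bounded r `&` [set K | inner_boundary K o]) q K < delta.
  rewrite -lte_fin -probability_clusters.
  apply: (@le_lt_trans _ _ (P (~` good n))).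
    apply: le_measure; rewrite ?inE.
    - apply: fin_bigcup_measurable => [|K _]; last exact: cluster_measurable.
      by apply: finite_setIl; exact: bounded_set_finite.
    - exact: measurableC.
    move=> w [K [_ [Ko [y nKy oy]]] wK] wgood; apply: nKy.
    rewrite -wK; apply: rt_step; apply: wgood; by exists o.
  rewrite probability_setC//; move: Pgood.
  rewrite -(fineK (fin_num_measure P _ (good_measurable n))).
  by rewrite -EFinB !lte_fin; lra.
(* The probability that [o] is on the inner boundary of its bounded cluster becomes an average of
   isoperimetric ratios, each at least [c]. *)
have mt : \sum_(K \in bounded r `&` [set K | inner_boundary K o]) q K =
    \sum_(K \in bounded r)
      q K * ((\sum_(x \in inner_boundary K) W x) / (\sum_(x \in K) W x)).
  apply: (mass_transport connG lfG subG transG (t := set_action va) (D1 := id)).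
  - by [].
  - by move=> g K _; exact: inner_boundary_image.
  - by move=> K x [].
  - exact: bounded_set_finite.
  - by move=> K [].
  - move=> K g [Ko Kr] Gg gKo; split=> // _ [x Kx <-] _ [y Ky <-].
    by rewrite -image_set1 ball_image; exists y => //; exact: Kr Ky.
  - move=> K x /bounded_finite fK; exact: stab_orbit_set_finite.
  - move=> K x Kr; apply: orbit_stab_finite => //; first exact: bounded_finite Kr.
    by exists o; case: Kr.
  - exact: bounded_finite.
  (* Here [o = g x]. As [x] and [o] both lie in [K], the event that [K] is the cluster of [x] is the
     event that it is the cluster of [o]. *)
  - move=> K g [Ko _] Gg [[x Kx gx] _]; congr fine.
    rewrite -[in LHS]gx cluster_image//; congr (P _).
    by apply/seteqP; split=> w /= wK; rewrite -wK in Kx Ko *;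
      [rewrite (comp_set_eq Ko)|rewrite (comp_set_eq Kx)].
have : c * (1 - delta) < delta.
  apply: le_lt_trans sum2; rewrite mt.
  apply: (@le_trans _ _ (\sum_(K \in bounded r) c * q K)).
    by rewrite -mulr_fsumr ler_wpM2l// ltW.
  apply: ler_fsum; first exact: bounded_set_finite.
  move=> K Kr; rewrite mulrC ler_wpM2l//; apply: iso; first exact: bounded_finite Kr.
  by exists o; case: Kr.
by move=> /(lt_trans deltac); rewrite ltxx.
Qed.

End Clusters.
End HyperfiniteToWeighted.

(** * Independent Bernoulli variables *)

Section FairBits.
Variable R : realType.

Let U01 : probability _ R := uniform_prob (@ltr01 R).

Lemma uniform01_itv (a b : R) : 0 <= a -> a <= b -> b <= 1 ->
  U01 `[a, b[%classic = (b - a)%:E.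
Proof.
move=> a0 ab b1; rewrite /U01 /= /uniform_prob.
rewrite (eq_integral (fun=> 1%:E)); last first.
  move=> x; rewrite inE /= in_itv /= => /andP[ax xb].
  by rewrite /uniform_pdf subr0 invr1 (le_trans a0 ax) (le_trans (ltW xb) b1).
rewrite integral_cst//= mul1e lebesgue_measure_itv /= lte_fin.
by case: ltP => // ba; rewrite (le_anti (introT andP (conj ab ba))) subrr.
Qed.

(** The first [n] binary digits of a [t] in the unit interval, read as an integer. *)
Definition dyadic n (t : R) : nat := Num.truncn (t * 2 ^+ n).

Lemma dyadic_half n t : 0 <= t -> dyadic n t = (dyadic n.+1 t)./2.
Proof.
move=> t0; apply: truncn_def; rewrite /dyadic.
have := truncn_itv (mulr_ge0 t0 (exprn_ge0 n.+1 (ler0n R 2))).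
set k := Num.truncn _; rewrite exprS mulrCA => /andP[k1 k2].
have := congr1 (fun n => n%:R : R) (odd_double_half k).
rewrite natrD -muln2 natrM => kE.
have kS : k.+1%:R = k%:R + 1 :> R by rewrite natr1.
have hS : (k./2).+1%:R = (k./2)%:R + 1 :> R by rewrite natr1.
rewrite kS in k2; rewrite hS; move: kE k1 k2; case: (odd k) => /=; lra.
Qed.

Lemma dyadic_lt n t : 0 <= t < 1 -> (dyadic n t < 2 ^ n)%N.
Proof.
move=> /andP[t0 t1]; rewrite /dyadic truncn_lt_nat ?mulr_ge0 ?exprn_ge0//.
by rewrite natrX -[ltRHS]mul1r ltr_pM2r// exprn_gt0.
Qed.

Let I01 : set R := `[0, 1[%classic.

Definition bit n (t : R) : bool := (0 <= t < 1) && odd (dyadic n.+1 t).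

Lemma dyadic_eq_itv n k : (k < 2 ^ n)%N ->
  `[0, 1[%classic `&` [set t | dyadic n t = k] =
  `[k%:R / 2 ^+ n, k.+1%:R / 2 ^+ n[%classic.
Proof.
move=> k2; have p0 : 0 < 2 ^+ n :> R by rewrite exprn_gt0.
apply/seteqP; split=> t; rewrite /= !in_itv /=.
  move=> [/andP[t0 t1] <-]; have := truncn_itv (mulr_ge0 t0 (ltW p0)).
  by rewrite ler_pdivrMr// ltr_pdivlMr.
rewrite ler_pdivrMr// ltr_pdivlMr// => /andP[kt tk].
have t0 : 0 <= t by rewrite -(pmulr_lge0 _ p0) (le_trans _ kt).
split; last by apply: truncn_def; rewrite kt tk.
rewrite t0 -(ltr_pM2r p0) mul1r (lt_le_trans tk)// -natrX ler_nat//.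
Qed.

Lemma uniform01_dyadic n (Q : pred nat) :
  measurable (I01 `&` [set t | Q (dyadic n t)]) /\
  U01 (I01 `&` [set t | Q (dyadic n t)]) =
    ((\sum_(0 <= k < 2 ^ n) Q k)%N%:R / 2 ^+ n)%:E.
Proof.
have p0 : 0 < 2 ^+ n :> R by rewrite exprn_gt0.
pose F (k : nat) : set R := `[k%:R / 2 ^+ n, k.+1%:R / 2 ^+ n[%classic.
pose D := `I_(2 ^ n) `&` [set k | Q k].
have fD : finite_set D by apply: finite_setIl; exact: finite_II.
have -> : I01 `&` [set t | Q (dyadic n t)] = \bigcup_(k in D) F k.
  apply/seteqP; split=> [t [t01 Qt]|t [k [/= k2 Qk]]].
    have tn : (dyadic n t < 2 ^ n)%N.
      by move: t01; rewrite /I01 /= in_itv /=; exact: dyadic_lt.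
    by exists (dyadic n t) => //; rewrite /F -dyadic_eq_itv.
  by rewrite /F -dyadic_eq_itv// => -[t01 /= tk]; split=> //=; rewrite tk.
have mF k : D k -> measurable (F k) by move=> _; exact: measurable_itv.
split; first exact: fin_bigcup_measurable.
rewrite measure_fin_bigcup//; last first.
  move=> i j [/= i2 _] [/= j2 _] [t []].
  by rewrite /F -!dyadic_eq_itv// => -[_ /= <-] [_ /= <-].
transitivity (\sum_(k \in D) (2 ^- n : R)%:E)%E.
  apply: eq_fsbigr => k /set_mem[/= k2 Qk]; rewrite uniform01_itv.
  - by rewrite -mulrBl -natr1 addrAC subrr add0r mul1r.
  - by rewrite divr_ge0// ltW.
  - by rewrite ler_pM2r ?invr_gt0// ler_nat.
  - by rewrite ler_pdivrMr// mul1r -natrX ler_nat.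
rewrite fsumEFin// fsum_const; congr ((_ / _)%:E).
rewrite ncard_sum fsbig_mkcondr -fsbig_ord big_mkord natr_sum.
apply: eq_bigr => k _; case: ifPn => [/set_mem/= -> //|/negP nQ].
by case: (boolP (Q k)) => // Qk; case: nQ; exact/mem_set.
Qed.

Lemma sum_double (F : nat -> nat) m :
  (\sum_(0 <= k < m.*2) F k = \sum_(0 <= k < m) (F k.*2 + F k.*2.+1))%N.
Proof.
elim: m => [|m IH]; first by rewrite !big_geq.
by rewrite doubleS !big_nat_recr//= IH addnA.
Qed.

(** Induction on [n]: a new digit doubles the number of integers, and prescribing it halves the
    number of admissible ones. *)
Lemma bits_pred n (e : pred nat) : exists Q : pred nat,
  (forall t, I01 t -> (forall i, (i < n)%N -> e i -> bit i t) <-> Q (dyadic n t)) /\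
  ((\sum_(0 <= k < 2 ^ n) Q k) * 2 ^ (\sum_(0 <= i < n) e i) = 2 ^ n)%N.
Proof.
elim: n => [|n [Q [QE Qn]]].
  by exists predT; split=> [t _|]; [split|rewrite big_nat1 big_geq].
exists (fun k => Q k./2 && (e n ==> odd k)); split=> [t t01|].
  have t0 : 0 <= t by move: t01; rewrite /I01 /= in_itv /= => /andP[].
  have bn : bit n t = odd (dyadic n.+1 t).
    by move: t01; rewrite /I01 /= in_itv /= /bit => ->.
  rewrite -dyadic_half//; split=> [h|/andP[/(QE t t01) h /implyP h']].
    apply/andP; split; first by apply/(QE t t01) => i ni; apply: h; exact: ltnW.
    by apply/implyP => en; rewrite -bn; exact: h.
  move=> i; rewrite ltnS leq_eqVlt => /predU1P[->|]; last exact: h.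
  by rewrite bn.
rewrite expnS mul2n sum_double big_nat_recr//= expnD.
(* Of the two extensions of [k], both are admissible if the new digit is free, and only the odd one
   if it is prescribed. *)
have -> : (\sum_(0 <= k < 2 ^ n)
    ((Q k.*2./2 && (e n ==> odd k.*2)) + (Q k.*2.+1./2 && (e n ==> odd k.*2.+1))) =
    (\sum_(0 <= k < 2 ^ n) Q k) * (~~ e n).+1)%N.
  rewrite big_distrl; apply: eq_bigr => k _ /=.
  rewrite doubleK uphalf_double odd_double /=.
  by case: (e n); rewrite ?andbF ?andbT ?implybT /=; case: (Q k).
rewrite -mul2n; set S := (\sum_(0 <= k < 2 ^ n) Q k)%N in Qn *; rewrite -{}Qn.
by case: (e n) => /=; rewrite ?expn1 ?expn0; ring.
Qed.

Lemma bit_measurable i : measurable [set t | bit i t].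
Proof.
have [+ _] := uniform01_dyadic i.+1 odd; congr measurable.
by apply/seteqP; split=> t; rewrite /bit /I01 /= in_itv /= => /andP.
Qed.

Lemma uniform01_bits n (e : pred nat) :
  U01 [set t | forall i, (i < n)%N -> e i -> bit i t] =
  (2 ^- (\sum_(0 <= i < n) e i)%N)%:E.
Proof.
set E := mkset _.
have mE : measurable E.
  rewrite (_ : E = \bigcap_(i in [set i | (i < n)%N /\ e i]) [set t | bit i t]).
    by apply: countable_bigcap_measurable => // i _; exact: bit_measurable.
  by apply/seteqP; split=> t h i; [move=> []|move=> ? ?]; apply: h.
have mI : measurable I01 by exact: measurable_itv.
have I1 : U01 I01 = 1%E by rewrite uniform01_itv// subr0.
(* [bit] is false off the unit interval, but with no digit prescribed [E] is the whole line; the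
   outside is null in any case. *)
have E0 : U01 (E `\` I01) = 0%E.
  apply/eqP; rewrite eq_le measure_ge0 andbT.
  apply: (@le_trans _ _ (U01 (~` I01))); last by rewrite probability_setC// I1 subee.
  apply: le_measure; rewrite ?inE; [exact: measurableD|exact: measurableC|].
  by move=> t [].
have [Q [QE Qn]] := bits_pred n e.
rewrite (measureDI U01 mE mI) [X in (X + _)%E](E0 : _ = _) add0e.
rewrite (_ : E `&` I01 = I01 `&` [set t | Q (dyadic n t)]); last first.
  by apply/seteqP; split=> t [? ?]; split=> //; apply/QE.
apply: (etrans (proj2 (uniform01_dyadic n Q))); congr (_%:E).
set S := (\sum_(0 <= k < 2 ^ n) _)%N in Qn *.
have QR : S%:R * 2 ^+ (\sum_(0 <= i < n) e i)%N = 2 ^+ n :> R.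
  by rewrite -!natrX -natrM Qn.
rewrite -QR invfM mulrA divff ?mul1r// pnatr_eq0; apply/eqP => S0.
by move/eqP: Qn; rewrite S0 mul0n eq_sym expn_eq0.
Qed.

End FairBits.

(** * Products with dyadic parameters *)

Section BernoulliProduct.
Variables (R : realType) (I : choiceType).

(** These events are closed under intersection and serve as generators of the sigma-algebra, so they
    determine a law; a product formula on them expresses independence. *)
Definition ones (J : {fset I}) : set (I -> bool) := [set u | forall i, i \in J -> u i].

Definition ones_system : set (set (I -> bool)) := range ones.

Definition bool_product := g_sigma_algebraType ones_system.

Lemma ones_measurable J : measurable (ones J : set bool_product).
Proof. by apply: sub_sigma_algebra; exists J. Qed.

Lemma coordinate_measurable i : measurable [set u : bool_product | u i].
Proof.
rewrite (_ : mkset _ = ones [fset i]%fset); first exact: ones_measurable.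
apply/seteqP; split=> u; last by apply; rewrite in_fset1.
by move=> ui j; rewrite in_fset1 => /eqP ->.
Qed.

Lemma onesU (J K : {fset I}) : ones (J `|` K)%fset = ones J `&` ones K.
Proof.
apply/seteqP; split=> u => [JK|[uJ uK] i].
  by split=> i iJ; apply: JK; rewrite in_fsetU iJ ?orbT.
by rewrite in_fsetU => /orP[/uJ|/uK].
Qed.

Lemma ones0 : ones fset0 = setT.
Proof. by apply/seteqP; split. Qed.

Lemma bool_product_measure_unique (P Q : probability bool_product R) :
  (forall J, P (ones J) = Q (ones J)) -> forall A, measurable A -> P A = Q A.
Proof.
move=> PQ A mA; apply: (@measure_unique _ R bool_product ones_system
  (fun=> setT) erefl _ _ _ P Q) => //.
- by move=> _ _ [J _ <-] [K _ <-]; exists (J `|` K)%fset => //; rewrite onesU.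
- by move=> _; exists fset0 => //; exact: ones0.
- by apply/seteqP; split=> // u _; exists 0%N.
- by move=> _ [J _ <-]; exact: PQ.
- by move=> _; apply: (le_lt_trans (probability_le1 P measurableT)); exact: ltry.
Qed.

Section Existence.
Variables (c : I -> nat) (k : I -> nat).
Hypothesis c_inj : injective c.

(** The coordinate [i] is the conjunction of [k i] fair digits. Distinct coordinates use disjoint
    digits because [c] and the pairing of codes are injective. *)
Let threshold (t : measurableTypeR R) : bool_product :=
  fun i => [forall j : 'I_(k i), bit (choice.pickle (c i, val j)) t].

Let codes (J : {fset I}) := [seq choice.pickle (c i, j) | i <- J, j <- iota 0 (k i)].

Let codes_uniq J : uniq (codes J).
Proof.
apply: allpairs_uniq_dep; [exact: fset_uniq|by move=> i _; exact: iota_uniq|].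
move=> [i j] [i' j'] _ _ /= /(pcan_inj choice.pickleK) [] /c_inj.
by move=> ii' jj'; subst.
Qed.

Let preimage_ones J n : (forall m, m \in codes J -> (m < n)%N) ->
  threshold @^-1` ones J =
  [set t | forall m, (m < n)%N -> m \in codes J -> bit m t].
Proof.
move=> Jn; apply/seteqP; split=> t ht.
  move=> m _ /allpairsPdep[i [j [iJ jk ->]]]; have := ht i iJ.
  by move=> /forallP; move: jk; rewrite mem_iota add0n => /= jk /(_ (Ordinal jk)).
move=> i iJ; apply/forallP => j.
have mJ : choice.pickle (c i, val j) \in codes J.
  by apply/allpairsPdep; exists i, (val j); split=> //; rewrite mem_iota add0n /=.
by apply: ht => //; exact: Jn.
Qed.

Let codes_bound J : exists n, forall m, m \in codes J -> (m < n)%N.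
Proof.
exists (\max_(m <- codes J) m).+1 => m mJ.
by rewrite ltnS; apply: (@leq_bigmax_seq _ _ _ id).
Qed.

Let threshold_measurable : measurable_fun setT threshold.
Proof.
apply: (@measurability _ _ (measurableTypeR R) bool_product setT threshold
  ones_system erefl).
move=> _ [_ [J _ <-] <-]; rewrite setTI.
have [n Jn] := codes_bound J; rewrite (preimage_ones Jn).
rewrite (_ : mkset _ = \bigcap_(m in [set m | (m < n)%N /\ m \in codes J])
    [set t | bit m t]).
  by apply: countable_bigcap_measurable => // m _; exact: bit_measurable.
by apply/seteqP; split=> t h m; [move=> []|move=> ? ?]; apply: h.
Qed.

HB.instance Definition _ := isMeasurableFun.Build _ _ _ _ threshold threshold_measurable.

(** The law of [threshold] at a uniform point: on [ones J] exactly the distinct digits listed in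
    [codes J] are prescribed. *)
Lemma bernoulli_product : exists P : probability bool_product R,
  forall J, P (ones J) = (2 ^- (\sum_(i <- J) k i)%N)%:E.
Proof.
exists (distribution (uniform_prob (@ltr01 R)) threshold) => J.
have [n Jn] := codes_bound J.
rewrite -[LHS]/(uniform_prob (@ltr01 R) (threshold @^-1` ones J)).
rewrite (preimage_ones Jn).
apply: (etrans (uniform01_bits R n (fun m => m \in codes J))); congr ((2 ^- _)%:E).
transitivity (size (codes J)); last first.
  by rewrite size_allpairs_dep sumnE big_map; apply: eq_bigr => i _; rewrite size_iota.
transitivity (count (mem (codes J)) (iota 0 n)).
  rewrite -sum1_count /index_iota subn0 [RHS]big_mkcond.
  by apply: eq_bigr => i _; rewrite /=; case: (i \in _).
rewrite -size_filter; apply: perm_size; apply: uniq_perm => //.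
  by rewrite filter_uniq// iota_uniq.
move=> m; rewrite mem_filter mem_iota add0n /=.
by apply/andP/idP => [[]//|mJ]; split=> //; exact: Jn.
Qed.

End Existence.

Section Precompose.
Variable s : I -> I.

Definition precompose (u : bool_product) : bool_product := u \o s.

Lemma preimage_precompose J : precompose @^-1` ones J = ones (s @` J)%fset.
Proof.
apply/seteqP; split=> u h; first by move=> _ /imfsetP[i iJ ->]; exact: h.
by move=> i iJ; apply: h; exact: in_imfset.
Qed.

Lemma precompose_measurable : measurable_fun setT precompose.
Proof.
apply: (@measurability _ _ bool_product bool_product setT precompose ones_system erefl).
move=> _ [_ [J _ <-] <-]; rewrite setTI preimage_precompose.
exact: ones_measurable.
Qed.

HB.instance Definition _ :=
  isMeasurableFun.Build _ _ _ _ precompose precompose_measurable.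

End Precompose.

Section Law.
Variables (k : I -> nat) (P : probability bool_product R).
Hypothesis Pones : forall J, P (ones J) = (2 ^- (\sum_(i <- J) k i)%N)%:E.

(** The image law takes the same values on the events [ones J], as [s] only renames [J] and
    preserves the parameters. *)
Lemma bernoulli_invariant (s : I -> I) : injective s -> (forall i, k (s i) = k i) ->
  forall A, measurable A -> P (precompose s @^-1` A) = P A.
Proof.
move=> sI ks A mA.
apply: (bool_product_measure_unique (P := distribution P (precompose s))) => // J.
rewrite Pones.
rewrite -[LHS]/(P (precompose s @^-1` ones J)).
rewrite preimage_precompose Pones big_imfset/=; last by move=> i j _ _; exact: sI.
by congr ((2 ^- _)%:E); apply: eq_bigr => i _.
Qed.

Definition zeros (A : seq I) : set bool_product := [set u | forall i, i \in A -> ~~ u i].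

Lemma zeros_measurable A : measurable (zeros A).
Proof.
elim: A => [|a A IH].
  by rewrite (_ : zeros _ = setT)//; apply/seteqP; split.
rewrite (_ : zeros _ = zeros A `&` ~` [set u : bool_product | u a]).
  by apply: measurableI => //; apply: measurableC; exact: coordinate_measurable.
apply/seteqP; split=> u.
  move=> z; split; first by move=> i iA; apply: z; rewrite in_cons iA orbT.
  by apply/negP; apply: z; exact: mem_head.
by move=> [z /negP ua] i; rewrite in_cons => /predU1P[->//|/z].
Qed.

(** Induction on [A]: from the event for the tail, remove the part where [u a] holds, which is the
    same event with [a] added to [J]. *)
Lemma probability_ones_zeros m (J : {fset I}) A : uniq A ->
  (forall i, i \in A -> i \notin J /\ k i = m) ->
  P (ones J `&` zeros A) =
  (2 ^- (\sum_(i <- J) k i)%N * (1 - 2 ^- m) ^+ size A)%:E.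
Proof.
elim: A J => [|a A IH] J /=.
  move=> _ _; rewrite (_ : zeros _ = setT) ?setIT ?mulr1 ?Pones//.
  by apply/seteqP; split.
move=> /andP[aA uA] AJ; have [aJ ka] := AJ a (mem_head _ _).
have mz := measurableI _ _ (ones_measurable J) (zeros_measurable A).
rewrite (_ : ones J `&` zeros (a :: A) =
    (ones J `&` zeros A) `\` [set u : bool_product | u a]); last first.
  apply/seteqP; split=> u [].
    move=> uJ z; split; last by apply/negP; apply: z; exact: mem_head.
    by split=> // i iA; apply: z; rewrite in_cons iA orbT.
  move=> [uJ z] /negP ua; split=> // i.
  by rewrite in_cons => /predU1P[->//|/z].
transitivity (P (ones J `&` zeros A) -
    P ((ones J `&` zeros A) `&` [set u : bool_product | u a]))%E.
  apply: measureD => //; first exact: coordinate_measurable.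
  by rewrite (le_lt_trans (probability_le1 P mz))// ltry.
rewrite (_ : (ones J `&` zeros A) `&` [set u : bool_product | u a] =
    ones (a |` J)%fset `&` zeros A); last first.
  rewrite onesU setIAC; congr (_ `&` _); rewrite setIC; congr (_ `&` _).
  apply/seteqP; split=> u; last by apply; rewrite in_fset1.
  by move=> ua j; rewrite in_fset1 => /eqP ->.
rewrite !IH//; last 2 first.
- move=> i iA; have [iJ ki] := AJ i (mem_behead (s := a :: A) iA); split=> //.
  by rewrite in_fset1U negb_or iJ andbT; apply: contraNneq aA => <-.
- by move=> i iA; apply: AJ; rewrite in_cons iA orbT.
rewrite -EFinB big_fsetU1//= ka; congr (_%:E).
by rewrite exprS exprD invfM; ring.
Qed.

Lemma probability_zeros m A : uniq A -> (forall i, i \in A -> k i = m) ->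
  P (zeros A) = ((1 - 2 ^- m) ^+ size A)%:E.
Proof.
move=> uA kA; have := @probability_ones_zeros m fset0 A uA.
rewrite ones0 setTI big_seq_fset0 expr0 invr1 mul1r => -> // i iA.
by split=> //; exact: kA.
Qed.

End Law.
End BernoulliProduct.

(** * Weighted amenability implies hyperfiniteness *)

Section FsetAction.
Variables (V : choiceType) (G : graph V).

Lemma pred_set_inj : injective (fun K : {fset V} => [set` K]).
Proof. by move=> K L KL; rewrite -(set_fsetK K) -(set_fsetK L) KL. Qed.

Lemma set_imfset_aut (g : aut G) (K : {fset V}) : [set` (g @` K)%fset] = g @` [set` K].
Proof. exact: set_imfset. Qed.

Lemma fset_act1 (K : {fset V}) : ((1%g : aut G) @` K = K)%fset.
Proof.
apply: pred_set_inj; apply: (etrans (set_imfset_aut _ _)).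
exact: (act1 (set_action (vertex_action G))).
Qed.

Lemma fset_actM (g h : aut G) (K : {fset V}) : ((g * h)%g @` K = g @` (h @` K))%fset.
Proof.
apply: pred_set_inj; apply: (etrans (set_imfset_aut _ _)).
rewrite -[RHS]/([set` (g @` (h @` K))%fset]) !set_imfset_aut.
exact: (actM (set_action (vertex_action G))).
Qed.

(** Translates are finite sets by type, which makes the indices of the Bernoulli variables
    countable. *)
Definition fset_action : action G {fset V} :=
  Action (act := fun g K => (g @` K)%fset) fset_act1 fset_actM.

Lemma vertex_boundary_image (g : aut G) F :
  vertex_boundary (adj G) (g @` F) = g @` vertex_boundary (adj G) F.
Proof.
rewrite !vertex_boundaryE neighbors_image; apply/seteqP; split.
  move=> _ [[y Ny <-] nF]; exists y => //; split=> // Fy; apply: nF; by exists y.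
move=> _ [y [Ny nF] <-]; split; first by exists y.
by move=> [z Fz /(can_inj (aut_funK g)) zy]; apply: nF; rewrite -zy.
Qed.

Variable Gamma : set (aut G).
Hypothesis connG : connected_graph G.
Hypothesis lfG : locally_finite G.

Lemma stab_orbit_fset_finite x (K : {fset V}) :
  finite_set (orbit fset_action (stab (vertex_action G) Gamma x) K).
Proof.
apply: (@sub_finite_set _ _ ((fun L : {fset V} => [set` L]) @^-1`
    orbit (set_action (vertex_action G)) (stab (vertex_action G) Gamma x) [set` K])).
  by move=> _ [g gx <-]; exists g => //=; rewrite set_imfset_aut.
apply: finite_preimage; first by move=> K1 K2 _ _; exact: pred_set_inj.
exact/stab_orbit_set_finite/finite_fset.
Qed.

Lemma orbit_stab_fset_finite (K : {fset V}) y : [set` K] !=set0 ->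
  finite_set (orbit (vertex_action G) (stab fset_action Gamma K) y).
Proof.
move=> K0; apply: sub_finite_set (orbit_stab_finite Gamma connG lfG y (finite_fset K) K0).
move=> _ [g [Gg gK] <-]; exists g => //; split=> //=.
by rewrite -set_imfset_aut -[in RHS]gK.
Qed.

End FsetAction.

(** * The selection probability *)

Section Thinning.
Variable R : realType.

Lemma expr1B_le (p : R) n : 0 <= p <= 1 -> (1 - p) ^+ n * (1 + n%:R * p) <= 1.
Proof.
move=> /andP[p0 p1]; elim: n => [|n IH]; first by rewrite expr0 mul0r addr0 mulr1.
apply: le_trans IH; rewrite exprS -mulrA mulrCA ler_wpM2l ?exprn_ge0 ?subr_ge0//.
have n0 : 0 <= n%:R :> R by [].
by rewrite -natr1; nra.
Qed.

(* The probability [2 ^- k] makes both the expected number of boundary hits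
   and the probability of not being covered small. *)
Lemma thinning (N Nb M : nat) : (0 < N)%N -> (0 < M)%N ->
  Nb%:R * (2 * M%:R ^+ 2) <= N%:R :> R ->
  exists k, Nb%:R * 2 ^- k <= M%:R^-1 :> R /\ (1 - 2 ^- k) ^+ N <= M%:R^-1 :> R.
Proof.
move=> N0 M0 NbN; have Mr : 0 < M%:R :> R by rewrite ltr0n.
have [Nb0|Nb0] := posnP Nb.
  (* Without boundary hits every translate can be selected with probability 1. *)
  exists 0%N; rewrite Nb0 mul0r expr0 invr1 subrr expr0n (gtn_eqF N0).
  by rewrite invr_ge0 ltW.
(* The power [2 ^ k] lies between [x] and [2 * x]. The lower bound controls the boundary hits; the
   upper one gives [N * 2 ^- k >= M], to which [expr1B_le] applies. *)
pose x := (Nb * M)%N; have x0 : (0 < x)%N by rewrite muln_gt0 Nb0.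
pose k := up_log 2 x; exists k.
have k1 : (x <= 2 ^ k)%N by exact: up_logP.
have k2 : (2 ^ k <= 2 * x)%N.
  have [x1|x1] := leqP x 1; first by rewrite /k (_ : x = 1%N) ?up_log1//; lia.
  have := up_log_gtn (isT : (1 < 2)%N) x1; rewrite -/k.
  have k0 : (0 < k)%N by rewrite up_log_gt0.
  by rewrite -[in X in _ -> X](prednK k0) expnS leq_mul2l /= => /ltnW.
have p0 : 0 < 2 ^+ k :> R by rewrite exprn_gt0.
have k1r : Nb%:R * M%:R <= 2 ^+ k :> R by rewrite -natrM -natrX ler_nat.
have k2r : 2 ^+ k <= 2 * (Nb%:R * M%:R) :> R by rewrite -!natrM -natrX ler_nat.
split.
  by rewrite ler_pdivrMr// mulrC ler_pdivlMr.
have pp : 0 <= (2 ^- k : R) <= 1.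
  by rewrite invr_ge0 ltW//= invf_le1// exprn_ege1// ler1n.
have := expr1B_le N pp.
have MN : M%:R <= N%:R * 2 ^- k :> R.
  rewrite ler_pdivlMr//; apply: le_trans NbN.
  apply: le_trans (ler_wpM2l (ltW Mr) k2r) _.
  by rewrite le_eqVlt; apply/orP; left; apply/eqP; ring.
move=> h; rewrite -[leRHS]mul1r ler_pdivlMr//; apply: le_trans h.
apply: ler_wpM2l; last lra.
by rewrite exprn_ge0// subr_ge0; case/andP: pp.
Qed.

End Thinning.

Lemma subgraph_eq (V : choiceType) (G : graph V) (H K : subgraph G) :
  (forall x, vertices H x <-> vertices K x) ->
  (forall x y, edges H x y <-> edges K x y) -> H = K.
Proof.
case: H K => [v e es ea ev] [v' e' es' ea' ev'] /= vv' ee'.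
have ? : v = v' by apply/seteqP; split=> x /vv'.
have ? : e = e' by apply/funext => x; apply/funext => y; exact/propext.
by subst; congr Subgraph; exact: Prop_irrelevance.
Qed.

(** * Percolation by selected translates *)

Section Percolation.
Variables (R : realType) (V : choiceType) (G : graph V) (Gamma : set (aut G)).
Hypothesis connG : connected_graph G.
Hypothesis lfG : locally_finite G.
Hypothesis subG : subgroup Gamma.
Hypothesis transG : vertex_transitive Gamma.
Variable o : V.
Local Notation W := (weight R Gamma o).
Local Notation va := (vertex_action G).
Local Notation fa := (fset_action G).
Local Notation index := (nat * {fset V})%type.

Definition through (E : {fset V} -> set V) (F : {fset V}) (x : V) : set {fset V} :=
  orbit fa Gamma F `&` [set K | E K x].

Definition body (K : {fset V}) : set V := [set` K].

Definition rim (K : {fset V}) : set V := vertex_boundary (adj G) [set` K].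

Lemma body_act g K : body (fa g K) = g @` body K.
Proof. exact: set_imfset_aut. Qed.

Lemma rim_act g K : rim (fa g K) = g @` rim K.
Proof. by rewrite /rim [X in vertex_boundary _ X]body_act vertex_boundary_image. Qed.

Lemma body_finite K : finite_set (body K).
Proof. exact: finite_fset. Qed.

Lemma rim_finite K : finite_set (rim K).
Proof. by apply: boundary_finite => //; exact: finite_fset. Qed.

Section Through.
Variables (E : {fset V} -> set V) (F : {fset V}).
Hypothesis E_act : forall g K, E (fa g K) = g @` E K.
Hypothesis E_finite : forall K, finite_set (E K).
Hypothesis F0 : [set` F] !=set0.

Lemma through_finite x : finite_set (through E F x).
Proof.
apply: (orbit_through_finite subG x transG) => //.
by move=> y; exact: stab_orbit_fset_finite.
Qed.

Lemma ncard_throughE : (ncard (through E F o))%:R =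
  ratio R Gamma fa o F * \sum_(x \in E F) W x.
Proof.
apply: (ncard_orbit_through R connG lfG subG o transG) => //.
- by move=> y; exact: stab_orbit_fset_finite.
- by move=> y; exact: orbit_stab_fset_finite.
Qed.

Lemma ncard_through x : ncard (through E F x) = ncard (through E F o).
Proof.
have [g Gg <-] := transG o x.
rewrite -[RHS](ncard_image _ (act_inj (t := fa) (g := g))); congr ncard.
apply/seteqP; split=> [K [[h Gh hK] EK]|_ [K [[h Gh <-] EK] <-]].
  exists (fa g^-1%g K); last exact: actVK.
  split; first by exists (g^-1 * h)%g; [exact: subM (subV subG Gg) Gh|rewrite actM hK].
  suff : E (fa g^-1%g K) o by [].
  by rewrite E_act; exists (g o) => //; exact: aut_funK.
split; first by exists (g * h)%g; [exact: subM Gg Gh|exact: actM].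
by suff : E (fa g (fa h F)) (g o); [|rewrite E_act; exists o].
Qed.

End Through.

(** The numbers of translates with [o] in the body or on the rim are proportional to the two
    weights, so a set with weighted boundary ratio below [1 / (2 * M ^ 2)], where [M] is [2 ^ m],
    meets the condition of [thinning]. *)
Lemma tile_exists m : w_amenable R Gamma o -> exists Fk : {fset V} * nat,
  [/\ [set` Fk.1] !=set0,
      (ncard (through rim Fk.1 o))%:R * 2 ^- Fk.2 <= (2 ^+ m)^-1 :> R &
      (1 - 2 ^- Fk.2) ^+ ncard (through body Fk.1 o) <= (2 ^+ m)^-1 :> R].
Proof.
move=> /(w_amenableP R connG lfG subG o) wam.
have e0 : 0 < (2 * (2 ^ m)%:R ^+ 2 : R)^-1.
  by rewrite invr_gt0 mulr_gt0// exprn_gt0// ltr0n expn_gt0.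
have [F [fF F0 Fe]] := wam _ e0.
have F0' : [set` fset_set F] !=set0 by rewrite fset_setK.
have r0 : 0 < ratio R Gamma fa o (fset_set F).
  apply: ratio_gt0 => // x; first exact: stab_orbit_fset_finite.
  exact: orbit_stab_fset_finite.
have Nbody := ncard_throughE body_act body_finite F0'.
have Nrim := ncard_throughE rim_act rim_finite F0'.
rewrite /body /rim fset_setK// in Nbody Nrim.
have := @thinning R (ncard (through body (fset_set F) o))
  (ncard (through rim (fset_set F) o)) (2 ^ m).
case.
- rewrite -(ltr_nat R) Nbody mulr_gt0//; exact: sum_weight_gt0.
- by rewrite expn_gt0.
- rewrite Nbody Nrim -mulrA ler_pM2l// -ler_pdivlMr.
    by rewrite mulrC; exact: ltW.
  by rewrite -invr_gt0.
- by move=> k []; rewrite natrX => k1 k2; exists (fset_set F, k).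
Qed.

Variables (F : nat -> {fset V}) (k : nat -> nat).
Hypothesis F0 : forall m, [set` F m] !=set0.
Hypothesis rim_small : forall m,
  (ncard (through rim (F m) o))%:R * 2 ^- k m <= (2 ^+ m)^-1 :> R.
Hypothesis body_large : forall m,
  (1 - 2 ^- k m) ^+ ncard (through body (F m) o) <= (2 ^+ m)^-1 :> R.
Variable P : probability (bool_product index) R.
Hypothesis Pones : forall J, P (ones J) = (2 ^- (\sum_(i <- J) k i.1)%N)%:E.

Definition hit (E : {fset V} -> set V) m x : set (bool_product index) :=
  [set u | exists2 K, through E (F m) x K & u (m, K)].

(** Edges at bad vertices are deleted; at the others some selected translate covers the vertex and
    no selected one has it on its rim. *)
Definition bad m x := ~` hit body m x `|` hit rim m x.

Lemma hitE E m x : hit E m x =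
  \bigcup_(K in through E (F m) x) [set u : bool_product index | u (m, K)].
Proof. by []. Qed.

Lemma hit_measurable E m x : (forall g K, E (fa g K) = g @` E K) ->
  (forall K, finite_set (E K)) -> measurable (hit E m x).
Proof.
move=> E1 E2; rewrite hitE; apply: fin_bigcup_measurable.
  exact: through_finite.
by move=> K _; exact: coordinate_measurable.
Qed.

Lemma bad_measurable m x : measurable (bad m x).
Proof.
apply: measurableU; last exact: hit_measurable rim_act rim_finite.
by apply: measurableC; exact: hit_measurable body_act body_finite.
Qed.

Lemma probability_hit_rim m x : (P (hit rim m x) <= (2 ^- m)%:E)%E.
Proof.
have fT : finite_set (through rim (F m) x).
  by apply: through_finite; [exact: rim_act|exact: rim_finite].
have mc K : measurable [set u : bool_product index | u (m, K)].
  exact: coordinate_measurable.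
apply: (@le_trans _ _ (\sum_(K \in through rim (F m) x)
    P [set u : bool_product index | u (m, K)])%E).
  by apply: content_sub_fsum => //; exact: hit_measurable rim_act rim_finite.
have Pc K : P [set u : bool_product index | u (m, K)] = (2 ^- k m)%:E.
  have := Pones [fset (m, K)]%fset; rewrite big_seq_fset1 /= => <-.
  congr (P _); apply/seteqP; split=> u; last by apply; rewrite in_fset1.
  by move=> ua j; rewrite in_fset1 => /eqP ->.
rewrite (eq_fsbigr (fun=> (2 ^- k m)%:E)); last by move=> K _; exact: Pc.
rewrite fsumEFin// fsum_const lee_fin (ncard_through (F m) rim_act).
exact: rim_small.
Qed.

(** All the independent variables of the translates covering [x] have to vanish. *)
Lemma probability_not_hit_body m x : (P (~` hit body m x) <= (2 ^- m)%:E)%E.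
Proof.
have fT : finite_set (through body (F m) x).
  by apply: through_finite; [exact: body_act|exact: body_finite].
pose A : seq index := [seq (m, K) | K <- fset_set (through body (F m) x)].
have uA : uniq A by rewrite map_inj_uniq ?fset_uniq// => K L [].
have kA i : i \in A -> k i.1 = k m by move=> /mapP[K _ ->].
rewrite (_ : ~` _ = zeros A); last first.
  apply/seteqP; split=> u.
    move=> nu _ /mapP[K + ->]; rewrite in_fset_set// inE => TK.
    by apply/negP => uK; apply: nu; exists K.
  move=> zu [K TK uK]; have := zu (m, K); rewrite uK => h.
  have : false by apply: h; apply: map_f; rewrite in_fset_set// inE.
  by [].
rewrite (probability_zeros Pones uA kA) lee_fin size_map.
by rewrite -[size _]/(ncard _) (ncard_through (F m) body_act).
Qed.

Lemma probability_bad m x : (P (bad m x) <= (2 ^- m + 2 ^- m)%:E)%E.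
Proof.
have mb := hit_measurable m x body_act body_finite.
apply: (@le_trans _ _ (P (~` hit body m x) + P (hit rim m x))%E).
  apply: measureU2; first exact: measurableC.
  exact: hit_measurable rim_act rim_finite.
by rewrite EFinD leeD//; [exact: probability_not_hit_body|exact: probability_hit_rim].
Qed.

Lemma negligible_bad_io x : P (lim_sup_set (bad^~ x)) = 0%E.
Proof.
apply: lim_sup_set_cvg0; first by move=> m; exact: bad_measurable.
(* The bound [2 ^- m + 2 ^- m] is rewritten as [4 / 2 ^ m.+1], the form of a geometric series
   already summed in [epsilon_trick0]. *)
apply: (@le_lt_trans _ _ (\sum_(m <oo) (4 / (2 ^ m.+1)%:R)%:E)%E).
  apply: lee_nneseries => // m _; apply: le_trans (probability_bad m x) _.
  by rewrite lee_fin natrX exprS; lra.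
by apply: (le_lt_trans (epsilon_trick0 _ _)) => //; exact: ltry.
Qed.

Definition exceptional : set (bool_product index) :=
  \bigcup_x lim_sup_set (bad^~ x).

(** All scales from [n] on are imposed at once, which makes the percolations increasing in [n]. *)
Definition percolation_edges n (u : bool_product index) x y :=
  adj G x y /\
  (exceptional u \/ forall m, (n <= m)%N -> ~ bad m x u /\ ~ bad m y u).

Lemma percolation_sym n u x y : percolation_edges n u x y -> percolation_edges n u y x.
Proof.
move=> [xy H]; split; first exact: adj_sym.
by case: H => [?|H]; [left|right=> m /H[]].
Qed.

(* On the null event [exceptional] everything is kept, so that the union of
   the percolations is the full graph surely. *)
Definition percolation n u : configuration G :=
  @Subgraph V G setT (percolation_edges n u) (@percolation_sym n u)
    (fun _ _ => @proj1 _ _) (fun _ _ _ => I).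

Lemma exceptional_measurable : measurable exceptional.
Proof.
apply: countable_bigcup_measurable; first exact: vertices_countable connG lfG o.
move=> x _; apply: bigcapT_measurable => n.
by apply: bigcup_measurable => m _; exact: bad_measurable.
Qed.

Lemma exceptional_null : P exceptional = 0%E.
Proof.
apply: countable_bigcup_null; first exact: vertices_countable connG lfG o.
  move=> x; apply: bigcapT_measurable => n.
  by apply: bigcup_measurable => m _; exact: bad_measurable.
exact: negligible_bad_io.
Qed.

Lemma percolation_measurable n : measurable_fun setT (percolation n).
Proof.
have := @measurability _ _ (bool_product index) (configuration G) setT
  (percolation n) (@subgraph_cylinders V G) erefl; apply.
move=> _ [_ [[x _ <-]|[[x y] _ <-]] <-]; rewrite setTI.
  by rewrite (_ : _ @^-1` _ = setT)//; apply/seteqP; split.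
have [xy|nxy] := pselect (adj G x y); last first.
  by rewrite (_ : _ @^-1` _ = set0)//; apply/seteqP; split=> u // [].
rewrite (_ : _ @^-1` _ = exceptional `|`
    \bigcap_(m in [set m | (n <= m)%N]) (~` bad m x `&` ~` bad m y)).
  apply: measurableU; first exact: exceptional_measurable.
  apply: countable_bigcap_measurable => // m _.
  by apply: measurableI; apply: measurableC; exact: bad_measurable.
apply/seteqP; split=> u => [[_ [?|h]]|[?|h]]; first by left.
- by right.
- by split=> //; left.
- by split=> //; right.
Qed.

HB.instance Definition _ n :=
  isMeasurableFun.Build _ _ _ _ (percolation n) (percolation_measurable n).


Lemma percolation_cover u x y : adj G x y -> exists n, edges (percolation n u) x y.
Proof.
move=> xy; have [ex|nex] := pselect (exceptional u).
  by exists 0%N; split=> //; left.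
have good z : exists n, forall m, (n <= m)%N -> ~ bad m z u.
  apply: contrapT => /forallNP h; apply: nex; exists z => // n _.
  have /existsNP[m /not_implyP[nm /contrapT bm]] := h n.
  by exists m.
have [i xi] := good x; have [j yj] := good y.
exists (maxn i j); split=> //; right=> m; rewrite geq_max => /andP[im jm].
by split; [exact: xi|exact: yj].
Qed.

(** A bad vertex is isolated. Any other vertex lies in a selected translate [K] at scale [n], and a
    path leaving [K] would step on its rim, where vertices are bad. *)
Lemma percolation_cluster_finite n u x : ~ exceptional u ->
  finite_set (comp_set (percolation n u) x).
Proof.
move=> nex; have edge y z : edges (percolation n u) y z ->
    [/\ adj G y z, ~ bad n y u & ~ bad n z u].
  by move=> [yz [//|/(_ n (leqnn n))[]]].
have [bx|nbx] := pselect (bad n x u).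
  apply: (@sub_finite_set _ _ [set x]); last exact: finite_set1.
  move=> y /comp_set_sym xy.
  by elim: (clos_rt_rtn1 _ _ _ _ xy) bx => // v w /edge[_ _ nbw] _ _ /nbw.
have [K [KF Kx] uK] : hit body n x u by apply: contrapT => nh; apply: nbx; left.
apply: (@sub_finite_set _ _ (body K)); last exact: body_finite.
move=> y xy; elim: (clos_rt_rtn1 _ _ _ _ xy) => // v w /edge[vw _ nbw] _ Kv.
apply: contrapT => nKw; apply: nbw; right; exists K => //; split=> //.
by split=> //; exists v.
Qed.

(** * Invariance of the joint law *)

Section Equivariance.
Variable g : aut G.
Hypothesis Gg : Gamma g.

(** After precomposition with [shift], the translate of [K] by [g] is selected exactly when [K]
    was. *)
Let shift (i : index) : index := (i.1, fa g^-1%g i.2).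

Let shift_inj : injective shift.
Proof.
move=> [m K] [n L] [-> KL]; congr pair.
by apply: (@act_inj _ _ _ fa g^-1%g); exact: KL.
Qed.

Let hit_shift E m x u : (forall g K, E (fa g K) = g @` E K) ->
  hit E m (g x) (precompose shift u) <-> hit E m x u.
Proof.
move=> E_act; split=> -[K [[h Gh hK] EK] uK].
  exists (fa g^-1%g K) => //; split.
    by exists (g^-1 * h)%g; [exact: subM (subV subG Gg) Gh|rewrite actM hK].
  suff : E (fa g^-1%g K) x by [].
  by rewrite E_act; exists (g x) => //; exact: aut_funK.
exists (fa g K).
  split; first by exists (g * h)%g; [exact: subM Gg Gh|rewrite actM hK].
  by suff : E (fa g K) (g x); [|rewrite E_act; exists x].
by rewrite /precompose /shift /comp [fa g^-1%g _]actK.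
Qed.

Let bad_shift m x u : bad m (g x) (precompose shift u) <-> bad m x u.
Proof.
split=> -[nh|h].
- by left=> h; apply: nh; apply/(hit_shift m x u body_act).
- by right; apply/(hit_shift m x u rim_act).
- by left=> h; apply: nh; apply/(hit_shift m x u body_act).
- by right; apply/(hit_shift m x u rim_act).
Qed.

Let exceptional_shift u : exceptional (precompose shift u) <-> exceptional u.
Proof.
split=> -[x _ xio].
  exists (aut_inv g x) => // n _; have [m nm bm] := xio n I.
  by exists m => //; apply/bad_shift; rewrite aut_invK.
exists (g x) => // n _; have [m nm bm] := xio n I.
by exists m => //; apply/bad_shift.
Qed.

Let percolation_shift n u :
  percolation n (precompose shift u) = subgraph_act g (percolation n u).
Proof.
apply: subgraph_eq => [x|x y] /=.
  by split=> // _; exists (aut_inv g x) => //; exact: aut_invK.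
split.
  move=> [xy H]; exists (aut_inv g x), (aut_inv g y); rewrite !aut_invK; split=> //.
  split; first by apply/(aut_adj g); rewrite !aut_invK.
  case: H => [/exceptional_shift ?|H]; [by left|right=> m /H].
  by rewrite -[in X in X -> _](aut_invK g x) -[in X in X -> _](aut_invK g y) !bad_shift.
move=> [x' [y' [[xy H] <- <-]]]; split; first exact/aut_adj.
case: H => [?|H]; [by left; apply/exceptional_shift|right=> m /H].
by rewrite !bad_shift.
Qed.

(** Acting by [g] on the percolations amounts to renaming the Bernoulli variables by [shift], which
    preserves their law. *)
Lemma percolation_joint_invariant (A : set (joint_configuration G)) :
  let joint u : joint_configuration G := (full_subgraph G, percolation^~ u) in
  measurable (joint @^-1` A) ->
  P ((joint_act g \o joint) @^-1` A) = P (joint @^-1` A).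
Proof.
move=> joint mA; rewrite -[RHS](bernoulli_invariant Pones shift_inj)//.
suff -> : joint_act g \o joint = joint \o precompose shift by [].
apply/funext => u; rewrite /joint /joint_act /=; congr pair; last first.
  by apply/funext => n; rewrite percolation_shift.
apply: subgraph_eq => [x|x y] /=.
  by split=> // _; exists (aut_inv g x) => //; exact: aut_invK.
split=> [[x' [y' [xy <- <-]]]|xy]; first exact/aut_adj.
exists (aut_inv g x), (aut_inv g y); rewrite !aut_invK; split=> //.
by apply/(aut_adj g); rewrite !aut_invK.
Qed.

End Equivariance.

Lemma percolation_joint_measurable :
  measurable_fun setT (fun u =>
    (full_subgraph G, percolation^~ u) : joint_configuration G).
Proof.
apply/measurable_fun_pairP; split; first exact: measurable_cst.
have := @measurability _ _ (bool_product index)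
  (g_sigma_algebraType (@seq_cylinders _ (configuration G))) setT
  (fun u => percolation^~ u) (@seq_cylinders _ (configuration G)) erefl.
apply=> _ [_ [n [A [mA ->]]] <-]; rewrite setTI.
exact: (measurable_funPTI (percolation n) mA).
Qed.

Lemma percolation_exhaustion : @hyperfinite_exhaustion V G Gamma R _ _ P
  (cst (full_subgraph G)) (fun n => percolation n).
Proof.
split.
- move=> n u; split=> // x y [xy H]; split=> //.
  by case: H => [?|H]; [left|right=> m nm; exact/H/ltnW].
- move=> u; split; first by apply/seteqP; split=> // x _; exists 0%N.
  by move=> x y; split=> [[n []]//|]; exact: percolation_cover.
- move=> g Gg A mA; apply: (percolation_joint_invariant Gg (A := A)).
  by rewrite -[_ @^-1` _]setTI; exact: percolation_joint_measurable.
- move=> n; exists exceptional; split.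
  + exact: exceptional_measurable.
  + exact: exceptional_null.
  + move=> u nfin; apply: contrapT => nex; apply: nfin => x _.
    exact: percolation_cluster_finite.
Qed.

End Percolation.

Lemma w_amenable_hyperfinite (R : realType) (V : choiceType) (G : graph V)
    (Gamma : set (aut G)) (o : V) :
  connected_graph G -> locally_finite G -> subgroup Gamma ->
  vertex_transitive Gamma -> w_amenable R Gamma o -> hyperfinite Gamma R.
Proof.
move=> connG lfG subG transG wam.
have /choice[Fk FkP] := fun m => tile_exists connG lfG subG transG m wam.
have /countable_injP[c cI] := vertices_countable connG lfG o.
have {}cI : injective c by move=> x y; apply: cI; rewrite inE.
(* The vertices are countable, so pairs of a scale and a finite vertex set can be numbered
   injectively. *)
pose code (i : nat * {fset V}) := choice.pickle (i.1, [fset c x | x in i.2]%fset).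
have code_inj : injective code.
  move=> [m K] [n L] /(pcan_inj choice.pickleK) [-> KL]; congr pair.
  have sub (K1 K2 : {fset V}) : [fset c x | x in K1]%fset = [fset c x | x in K2]%fset ->
      forall x, x \in K1 -> x \in K2.
    move=> K12 x xK; have : c x \in [fset c x | x in K2]%fset by rewrite -K12 in_imfset.
    by move=> /imfsetP[y yK /cI ->].
  by apply/fsetP => x; apply/idP/idP; apply: sub.
have [P Pones] := bernoulli_product R (fun i => (Fk i.1).2) code_inj.
exists _, _, P; eexists.
by apply: (percolation_exhaustion connG lfG subG transG (o := o)
  (F := fun m => (Fk m).1) (k := fun m => (Fk m).2)) => // m; have [] := FkP m.
Qed.

Theorem theorem1p4 (R : realType) (V : choiceType) (G : graph V)
    (Gamma : set (aut G)) (o : V) :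
  connected_graph G -> locally_finite G ->
  subgroup Gamma -> closed Gamma -> vertex_transitive Gamma ->
  (w_amenable R Gamma o <-> level_amenable R Gamma) /\
  (level_amenable R Gamma <-> hyperfinite Gamma R).
Proof.
move=> connG lfG subG _ transG.
have w_level : w_amenable R Gamma o <-> level_amenable R Gamma.
  split; first exact: w_amenable_level_amenable.
  exact: level_amenable_w_amenable.
split=> //; split=> [/w_level|[d [T [P [om exh]]]]].
  exact: w_amenable_hyperfinite.
by apply/w_level; exact: hyperfinite_exhaustion_w_amenable exh.
Qed.
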